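(* Assume $N=\infty$ and $h(\underline{1})\ne0$. Then any finite-dimensional weight module $V$ over $A$ is semisimple.
   Context: Setting. $\mathbb{K}$ is an algebraically closed field of characteristic zero. $R$ is a finitely generated commutative $\mathbb{K}$-algebra, $\sigma$ a $\mathbb{K}$-algebra automorphism of $R$, $h\in R$, $\xi\in\mathbb{K}\setminus\{0\}$. $A=A(R,\sigma,h,\xi)$ is the associative unital algebra obtained from $R$ by adjoining $X_+,X_-$ with relations $X_\pm a=\sigma^{\pm1}(a)X_\pm$ ($a\in R$) and $X_+X_-=h+\xi X_-X_+$. It is assumed that $R$ is a Hopf algebra with structure $(\Delta,\varepsilon,S)$ and that there are $r_\pm,l_\pm,s_\pm\in R$ with: $(\sigma\otimes\mathrm{Id})\Delta=\Delta\sigma=(\mathrm{Id}\otimes\sigma)\Delta$ and $S\sigma=\sigma^{-1}S$ on $R$; $\Delta(h)=h\otimes r_+r_-+l_+l_-\otimes h$, $\varepsilon(h)=0$, $S(h)=-(l_+l_-r_+r_-)^{-1}h$; $r_\pm,l_\pm$ grouplike; $\sigma(l_\pm)\otimes\sigma(r_\mp)=\xi\,l_\pm\otimes r_\mp$; $(s_\pm)^{-1}=-l_\pm\sigma^{\pm1}(r_\pm)$. Then $A$ is a Hopf algebra extending $R$ via $\Delta(X_\pm)=X_\pm\otimes r_\pm+l_\pm\otimes X_\pm$, $\varepsilon(X_\pm)=0$, $S(X_\pm)=s_\pm X_\pm$. Weights. $G$ is the set of maximal ideals of $R$. For $\mathfrak m\in G$, $a\in R$, $a(\mathfrak m)\in\mathbb{K}$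 is the unique scalar with $a-a(\mathfrak m)\in\mathfrak m$. $\underline{0}=\ker\varepsilon|_R$ and $\underline{n}=\sigma^n(\underline{0})$ for $n\in\mathbb{Z}$. Torsion-freeness is assumed: $\sigma^n(\mathfrak m)\ne\mathfrak m$ for all $n\in\mathbb{Z}\setminus\{0\}$, $\mathfrak m\in G$. An $A$-module $V$ is a weight module if $V=\bigoplus_{\mathfrak m\in G}V_{\mathfrak m}$, where $V_{\mathfrak m}=\{v\in V:\mathfrak m v=0\}$. Notation. $r=r_+r_-$, $r_1=r(\underline{1})$ (a nonzero scalar). $N$ is the order of $\xi r_1$ if $(\xi r_1)^2\ne1$ and $\xi r_1$ is a root of unity, and $N=\infty$ otherwise. *)

(* Defs.v *)
From HB Require Import structures.
From mathcomp Require Import all_boot all_order all_algebra.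
From mathcomp Require Import boolp classical_sets.

Set Implicit Arguments.
Unset Strict Implicit.
Unset Printing Implicit Defensive.

Import GRing.Theory.
Local Open Scope ring_scope.
Local Open Scope classical_set_scope.
Local Open Scope quotient_scope.

(* [tensor U V] is the quotient of the formal sums of pairs [(u, v)] (encoded
   as sequences) that identifies two formal sums as soon as every bilinear map
   out of [U * V] takes the same value on both.  The universal property is
   [tlift_tens], [tlift_linear] and [tensor_ext]. *)

Definition bilin (K : fieldType) (U V W : lmodType K) (f : U -> V -> W) : Prop :=
  bilinear_for *:%R *:%R f.

Section Tensor.
Variables (K : fieldType) (U V : lmodType K).

Definition fsum (W : lmodType K) (f : U -> V -> W) (s : seq (U * V)) : W :=
  \sum_(p <- s) f p.1 p.2.

Definition tensor_eq (s t : seq (U * V)) : Prop :=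
  forall (W : lmodType K) (f : U -> V -> W), bilin f -> fsum f s = fsum f t.

Definition tensor_rel : rel (seq (U * V)) := fun s t => `[< tensor_eq s t >].

Lemma tensor_rel_refl : reflexive tensor_rel.
Proof. by move=> s; apply/asboolP. Qed.

Lemma tensor_rel_sym : symmetric tensor_rel.
Proof.
by move=> s t; apply/asboolP/asboolP => st W f bf; rewrite (st W f bf).
Qed.

Lemma tensor_rel_trans : transitive tensor_rel.
Proof.
move=> s t u /asboolP ts /asboolP su; apply/asboolP => W f bf.
by rewrite (ts W f bf) (su W f bf).
Qed.

Canonical tensor_equiv :=
  EquivRel tensor_rel tensor_rel_refl tensor_rel_sym tensor_rel_trans.

Definition tensor := {eq_quot tensor_equiv}.

HB.instance Definition _ := Choice.on tensor.
HB.instance Definition _ := EqQuotient.on tensor.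

Definition tlift (W : lmodType K) (f : U -> V -> W) (x : tensor) : W :=
  fsum f (repr x).

Lemma tlift_pi (W : lmodType K) (f : U -> V -> W) s : bilin f ->
  tlift f (\pi_tensor s) = fsum f s.
Proof.
move=> bf; have /eqquotP/asboolP/(_ W f bf) // : repr (\pi_tensor s) = s
  %[mod tensor] by rewrite reprK.
Qed.

Lemma pi_tensor_eq s t : tensor_eq s t -> \pi_tensor s = \pi_tensor t.
Proof. by move=> st; apply/eqquotP/asboolP. Qed.

Lemma fsum_repr (W : lmodType K) (f : U -> V -> W) s : bilin f ->
  fsum f (repr (\pi_tensor s)) = fsum f s.
Proof. exact: tlift_pi. Qed.

Definition tens (u : U) (v : V) : tensor := \pi_tensor [:: (u, v)].

Definition tzero : tensor := \pi_tensor [::].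
Definition tadd (x y : tensor) : tensor := \pi_tensor (repr x ++ repr y).
Definition tscale (c : K) (x : tensor) : tensor :=
  \pi_tensor [seq (c *: p.1, p.2) | p <- repr x].
Definition topp : tensor -> tensor := tscale (-1).

Lemma fsum_cat (W : lmodType K) (f : U -> V -> W) s t :
  fsum f (s ++ t) = fsum f s + fsum f t.
Proof. exact: big_cat. Qed.

Lemma fsum_scale (W : lmodType K) (f : U -> V -> W) c s : bilin f ->
  fsum f [seq (c *: p.1, p.2) | p <- s] = c *: fsum f s.
Proof.
move=> bf; rewrite /fsum big_map scaler_sumr; apply: eq_bigr => p _ /=.
have f0 : f 0 p.2 = 0.
  have := bf.1 p.2 1 0 0; rewrite /= !scale1r addr0 => /eqP.
  by rewrite -subr_eq subrr => /eqP.
by have := bf.1 p.2 c p.1 0; rewrite /= addr0 f0 addr0.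
Qed.

Definition fsumE := (fsum_repr, fsum_cat, fsum_scale).

Lemma tensor_pi_repr (x : tensor) : x = \pi_tensor (repr x).
Proof. by rewrite reprK. Qed.

Lemma taddA : associative tadd.
Proof.
by move=> x y z; apply: pi_tensor_eq => W f bf; rewrite !fsumE// addrA.
Qed.

Lemma taddC : commutative tadd.
Proof. by move=> x y; apply: pi_tensor_eq => W f bf; rewrite !fsumE// addrC. Qed.

Lemma tadd0 : left_id tzero tadd.
Proof.
move=> x; rewrite [RHS]tensor_pi_repr; apply: pi_tensor_eq => W f bf.
by rewrite !fsumE// {1}/fsum big_nil add0r.
Qed.

Lemma taddN : left_inverse tzero topp tadd.
Proof.
move=> x; apply: pi_tensor_eq => W f bf; rewrite !fsumE//.
by rewrite scaleN1r addNr /fsum big_nil.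
Qed.

HB.instance Definition _ := GRing.isZmodule.Build tensor taddA taddC tadd0 taddN.

Lemma tscaleA a b x : tscale a (tscale b x) = tscale (a * b) x.
Proof.
by apply: pi_tensor_eq => W f bf; rewrite !fsumE// scalerA.
Qed.

Lemma tscale1 : left_id 1 tscale.
Proof.
move=> x; rewrite [RHS]tensor_pi_repr; apply: pi_tensor_eq => W f bf.
by rewrite !fsumE// scale1r.
Qed.

Lemma tscaleDr : right_distributive tscale +%R.
Proof.
move=> c x y; apply: pi_tensor_eq => W f bf; rewrite !fsumE//.
by rewrite scalerDr.
Qed.

Lemma tscaleDl x : {morph tscale^~ x : a b / a + b}.
Proof.
move=> a b; apply: pi_tensor_eq => W f bf; rewrite !fsumE//.
by rewrite scalerDl.
Qed.

HB.instance Definition _ := GRing.Zmodule_isLmodule.Build K tensor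
  tscaleA tscale1 tscaleDr tscaleDl.

Lemma tensor_sum (x : tensor) : x = \sum_(p <- repr x) tens p.1 p.2.
Proof.
rewrite {1}(tensor_pi_repr x); elim: (repr x) => [|p s IH].
  by rewrite big_nil.
rewrite big_cons -IH; apply: pi_tensor_eq => W f bf.
by rewrite !fsumE// /fsum big_cons big_seq1.
Qed.

Lemma tens_bilin : bilin tens.
Proof.
split=> [v c u u'|u c v v'].
  apply: pi_tensor_eq => W f bf; rewrite !fsumE// /fsum !big_seq1 /=.
  exact: (bf.1 v c u u').
apply: pi_tensor_eq => W f bf; rewrite !fsumE// /fsum !big_seq1 /=.
exact: (bf.2 u c v v').
Qed.

Lemma tlift_tens (W : lmodType K) (f : U -> V -> W) u v : bilin f ->
  tlift f (tens u v) = f u v.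
Proof. by move=> bf; rewrite tlift_pi// /fsum big_seq1. Qed.

Lemma tlift_linear (W : lmodType K) (f : U -> V -> W) : bilin f ->
  linear (tlift f).
Proof. by move=> bf c x y; rewrite tlift_pi// !fsumE// !fsumE. Qed.

Lemma tensor_ext (W : lmodType K) (f g : tensor -> W) :
  linear f -> linear g -> (forall u v, f (tens u v) = g (tens u v)) -> f =1 g.
Proof.
move=> lf lg fg x; rewrite (tensor_sum x).
have lin0 (k : tensor -> W) : linear k -> k 0 = 0.
  move=> lk; have := lk 1 0 0; rewrite !scale1r addr0 => /eqP.
  by rewrite -subr_eq subrr => /eqP.
elim: (repr x) => [|p s IH]; first by rewrite big_nil !lin0.
rewrite big_cons; have := lf 1 (tens p.1 p.2); have := lg 1 (tens p.1 p.2).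
by rewrite !scale1r => -> ->; rewrite fg IH.
Qed.

End Tensor.

Definition tmap (K : fieldType) (U V U' V' : lmodType K)
    (f : U -> U') (g : V -> V') : tensor U V -> tensor U' V' :=
  tlift (fun u v => tens (f u) (g v)).

Definition tassoc (K : fieldType) (U V W : lmodType K) :
    tensor (tensor U V) W -> tensor U (tensor V W) :=
  tlift (fun x w => tlift (fun u v => tens u (tens v w)) x).

(* The library's [algType] requires [1 != 0], so the tensor product of two
   algebras is only recorded as a ring. *)

Section TensorAlgebra.
Variables (K : fieldType) (R S : algType K).
Local Notation T := (tensor R S).

Definition tone : T := tens 1 1.

Definition tmul (x y : T) : T :=
  tlift (fun a b => tlift (fun c d => tens (a * c) (b * d)) y) x.

Lemma tmulr_bilin a b : bilin (fun c d => tens (a * c) (b * d) : T).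
Proof.
have [tl tr] := tens_bilin R S.
split=> [d k c c'|c k d d'] /=; rewrite mulrDr -scalerAr.
  exact: tl.
exact: tr.
Qed.

Lemma tmull_bilin y :
  bilin (fun a b => tlift (fun c d => tens (a * c) (b * d)) y : T).
Proof.
have [tl tr] := tens_bilin R S.
split=> [b k a a'|a k b b'] /=; rewrite /tlift /fsum scaler_sumr -big_split /=;
  apply: eq_bigr => p _; rewrite mulrDl -scalerAl.
- exact: tl.
- exact: tr.
Qed.

Lemma tmul_linear_l y : linear (tmul^~ y).
Proof. exact: tlift_linear (tmull_bilin y). Qed.

Lemma tmul_linear_r x : linear (tmul x).
Proof.
move=> k y z; rewrite /tmul /tlift /fsum scaler_sumr -big_split /=.
apply: eq_bigr => p _; exact: (tlift_linear (tmulr_bilin p.1 p.2)).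
Qed.

Lemma tmul_tens a b c d : tmul (tens a b) (tens c d) = tens (a * c) (b * d).
Proof. by rewrite /tmul tlift_tens ?tlift_tens//; [exact: tmulr_bilin|exact: tmull_bilin]. Qed.

Lemma tmulA : associative tmul.
Proof.
move=> x y z.
have lc (f g : T -> T) : linear f -> linear g -> linear (f \o g).
  by move=> lf lg k u v; rewrite /= lg lf.
apply: (tensor_ext (f := tmul^~ (tmul y z))
         (g := fun t => tmul (tmul t y) z)) x.
- exact: tmul_linear_l.
- exact: (lc (tmul^~ z) (tmul^~ y)) (tmul_linear_l z) (tmul_linear_l y).
move=> a b.
apply: (tensor_ext (f := fun t => tmul (tens a b) (tmul t z))
         (g := fun t => tmul (tmul (tens a b) t) z)) y.
- exact: (lc _ (tmul^~ z)) (tmul_linear_r _) (tmul_linear_l z).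
- exact: (lc (tmul^~ z)) (tmul_linear_l z) (tmul_linear_r _).
move=> c d.
apply: (tensor_ext (f := fun t => tmul (tens a b) (tmul (tens c d) t))
         (g := tmul (tmul (tens a b) (tens c d)))) z.
- exact: lc (tmul_linear_r _) (tmul_linear_r _).
- exact: tmul_linear_r.
by move=> e f; rewrite !tmul_tens !mulrA.
Qed.

Lemma tmul1 : left_id tone tmul.
Proof.
apply: tensor_ext; first exact: tmul_linear_r.
  by move=> k x y.
by move=> a b; rewrite tmul_tens !mul1r.
Qed.

Lemma tmulr1 : right_id tone tmul.
Proof.
apply: tensor_ext; first exact: tmul_linear_l.
  by move=> k x y.
by move=> a b; rewrite tmul_tens !mulr1.
Qed.

Lemma tmulDl : left_distributive tmul +%R.
Proof.
by move=> x y z; have := tmul_linear_l z 1 x y; rewrite /= !scale1r.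
Qed.

Lemma tmulDr : right_distributive tmul +%R.
Proof.
by move=> x y z; have := tmul_linear_r x 1 y z; rewrite /= !scale1r.
Qed.

HB.instance Definition _ := GRing.Zmodule_isPzRing.Build T
  tmulA tmul1 tmulr1 tmulDl tmulDr.

End TensorAlgebra.

Record hopf_algebra (K : fieldType) (R : algType K) := HopfAlgebra {
  hcomul :> {rmorphism R -> tensor R R};
  hcounit : {lrmorphism R -> K | *%R};
  hantipode : {linear R -> R};
  hcomulZ : scalable hcomul;
  hcoassoc : forall a,
    tassoc (tmap hcomul id (hcomul a)) = tmap id hcomul (hcomul a);
  hcounitl : forall a, tlift (fun b c => hcounit b *: c) (hcomul a) = a;
  hcounitr : forall a, tlift (fun b c => hcounit c *: b) (hcomul a) = a;
  hantipodel : forall a,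
    tlift (fun b c => hantipode b * c) (hcomul a) = (hcounit a)%:A;
  hantipoder : forall a,
    tlift (fun b c => b * hantipode c) (hcomul a) = (hcounit a)%:A
}.

Definition grouplike (K : fieldType) (R : algType K) (H : hopf_algebra R)
    (g : R) : Prop :=
  hcomul H g = tens g g /\ hcounit H g = 1.

Record alg_aut (K : fieldType) (R : algType K) := AlgAut {
  aut_fun :> {lrmorphism R -> R};
  aut_inv : {lrmorphism R -> R};
  autK : cancel aut_fun aut_inv;
  autVK : cancel aut_inv aut_fun
}.

Definition aut_iter (K : fieldType) (R : algType K) (s : alg_aut R)
    (n : int) : R -> R :=
  match n with
  | Posz k => iter k s
  | Negz k => iter k.+1 (aut_inv s)
  end.

Definition fin_gen_alg (K : fieldType) (R : algType K) : Prop :=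
  exists s : seq R, forall B : set R,
    subalg_closed (mem B) -> (forall a, a \in s -> B a) -> B = setT.

(* [ambiskew] is the algebra [A(R, sigma, h, xi)], generated by [R], [X+] and
   [X-].  Two polynomial expressions in [X+], [X-] and elements of [R] are identified
   when they have the same value in every [K]-algebra under [R] containing two
   elements subject to the defining relations.  The universal property is
   given by [ambiskew_rel], [alift_in], [alift_Xp], [alift_Xm], [aliftD],
   [aliftM], [aliftZ] and [alift_unique]. *)

Section Ambiskew.
Variables (K : fieldType) (R : algType K).
Variables (sigma : alg_aut R) (h : R) (xi : K).

Definition ambiskew_relations (B : algType K) (f : R -> B) (xp xm : B) : Prop :=
  [/\ forall a, xp * f a = f (sigma a) * xp,
      forall a, xm * f a = f (aut_inv sigma a) * xm &
      xp * xm = f h + xi *: (xm * xp)].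

Inductive aexpr : Type :=
  | AConst of R
  | AXp
  | AXm
  | AAdd of aexpr & aexpr
  | AMul of aexpr & aexpr.

HB.instance Definition _ := gen_eqMixin aexpr.
HB.instance Definition _ := gen_choiceMixin aexpr.

Fixpoint aeval (B : algType K) (f : R -> B) (xp xm : B) (e : aexpr) : B :=
  match e with
  | AConst a => f a
  | AXp => xp
  | AXm => xm
  | AAdd e1 e2 => aeval f xp xm e1 + aeval f xp xm e2
  | AMul e1 e2 => aeval f xp xm e1 * aeval f xp xm e2
  end.

Definition aexpr_eq (e1 e2 : aexpr) : Prop :=
  forall (B : algType K) (f : {lrmorphism R -> B}) (xp xm : B),
    ambiskew_relations f xp xm -> aeval f xp xm e1 = aeval f xp xm e2.

Definition aexpr_rel : rel aexpr := fun s t => `[< aexpr_eq s t >].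

Lemma aexpr_rel_refl : reflexive aexpr_rel.
Proof. by move=> s; apply/asboolP. Qed.

Lemma aexpr_rel_sym : symmetric aexpr_rel.
Proof.
by move=> s t; apply/asboolP/asboolP => st B f xp xm r; rewrite (st B f xp xm r).
Qed.

Lemma aexpr_rel_trans : transitive aexpr_rel.
Proof.
move=> s t u /asboolP ts /asboolP su; apply/asboolP => B f xp xm r.
by rewrite (ts B f xp xm r) (su B f xp xm r).
Qed.

Canonical aexpr_equiv :=
  EquivRel aexpr_rel aexpr_rel_refl aexpr_rel_sym aexpr_rel_trans.

Definition ambiskew := {eq_quot aexpr_equiv}.

HB.instance Definition _ := Choice.on ambiskew.
HB.instance Definition _ := EqQuotient.on ambiskew.

Local Notation A := ambiskew.

Definition alift (B : algType K) (f : R -> B) (xp xm : B) (x : A) : B :=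
  aeval f xp xm (repr x).

Lemma alift_pi (B : algType K) (f : {lrmorphism R -> B}) xp xm e :
  ambiskew_relations f xp xm -> alift f xp xm (\pi_A e) = aeval f xp xm e.
Proof.
move=> r; have /eqquotP/asboolP/(_ B f xp xm r) // : repr (\pi_A e) = e
  %[mod A] by rewrite reprK.
Qed.

Lemma pi_ambiskew_eq s t : aexpr_eq s t -> \pi_A s = \pi_A t.
Proof. by move=> st; apply/eqquotP/asboolP. Qed.

Lemma aeval_repr (B : algType K) (f : {lrmorphism R -> B}) xp xm e :
  ambiskew_relations f xp xm ->
  aeval f xp xm (repr (\pi_A e)) = aeval f xp xm e.
Proof. exact: alift_pi. Qed.

Definition ain (a : R) : A := \pi_A (AConst a).
Definition Xp : A := \pi_A AXp.
Definition Xm : A := \pi_A AXm.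

Definition aadd (x y : A) : A := \pi_A (AAdd (repr x) (repr y)).
Definition amul (x y : A) : A := \pi_A (AMul (repr x) (repr y)).
Definition ascale (c : K) (x : A) : A := \pi_A (AMul (AConst c%:A) (repr x)).
Definition aopp : A -> A := ascale (-1).

Local Ltac solve_axiom :=
  let B := fresh "B" in let f := fresh "f" in let xp := fresh "xp" in
  let xm := fresh "xm" in let r := fresh "r" in
  apply: pi_ambiskew_eq => B f xp xm r;
  rewrite /= ?aeval_repr//= ?aeval_repr//= ?aeval_repr//=
    ?linearZ ?rmorph1 ?rmorph0 ?mulr_algl.

Lemma ambiskew_pi_repr (x : A) : x = \pi_A (repr x).
Proof. by rewrite reprK. Qed.

Lemma aaddA : associative aadd.
Proof. by move=> x y z; solve_axiom; rewrite addrA. Qed.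

Lemma aaddC : commutative aadd.
Proof. by move=> x y; solve_axiom; rewrite addrC. Qed.

Lemma aadd0 : left_id (ain 0) aadd.
Proof.
by move=> x; rewrite [RHS]ambiskew_pi_repr; solve_axiom; rewrite add0r.
Qed.

Lemma aaddN : left_inverse (ain 0) aopp aadd.
Proof. by move=> x; solve_axiom; rewrite scaleN1r addNr. Qed.

HB.instance Definition _ := GRing.isZmodule.Build A aaddA aaddC aadd0 aaddN.

Lemma amulA : associative amul.
Proof. by move=> x y z; solve_axiom; rewrite mulrA. Qed.

Lemma amul1 : left_id (ain 1) amul.
Proof.
by move=> x; rewrite [RHS]ambiskew_pi_repr; solve_axiom; rewrite mul1r.
Qed.

Lemma amulr1 : right_id (ain 1) amul.
Proof.
by move=> x; rewrite [RHS]ambiskew_pi_repr; solve_axiom; rewrite mulr1.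
Qed.

Lemma amulDl : left_distributive amul +%R.
Proof. by move=> x y z; solve_axiom; rewrite mulrDl. Qed.

Lemma amulDr : right_distributive amul +%R.
Proof. by move=> x y z; solve_axiom; rewrite mulrDr. Qed.

HB.instance Definition _ := GRing.Zmodule_isPzRing.Build A
  amulA amul1 amulr1 amulDl amulDr.

Lemma ascaleA a b x : ascale a (ascale b x) = ascale (a * b) x.
Proof. by solve_axiom; rewrite scalerA. Qed.

Lemma ascale1 : left_id 1 ascale.
Proof.
by move=> x; rewrite [RHS]ambiskew_pi_repr; solve_axiom; rewrite scale1r.
Qed.

Lemma ascaleDr : right_distributive ascale +%R.
Proof. by move=> c x y; solve_axiom; rewrite scalerDr. Qed.

Lemma ascaleDl x : {morph ascale^~ x : a b / a + b}.
Proof. by move=> a b; solve_axiom; rewrite scalerDl. Qed.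

HB.instance Definition _ := GRing.Zmodule_isLmodule.Build K A
  ascaleA ascale1 ascaleDr ascaleDl.

Lemma ambiskew_scalerAl (c : K) (x y : A) : c *: (x * y) = (c *: x) * y.
Proof. by solve_axiom; rewrite scalerAl. Qed.

Lemma ambiskew_scalerAr (c : K) (x y : A) : c *: (x * y) = x * (c *: y).
Proof. by solve_axiom; rewrite scalerAr. Qed.

Lemma ain_zmod : zmod_morphism ain.
Proof.
move=> a b; solve_axiom.
by rewrite raddfB scaleN1r.
Qed.

Lemma ain_monoid : monoid_morphism ain.
Proof. by split=> // a b; solve_axiom; rewrite rmorphM. Qed.

Lemma ain_scalable : scalable ain.
Proof. by move=> c a; solve_axiom. Qed.

HB.instance Definition _ := GRing.isZmodMorphism.Build R A ain ain_zmod.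
HB.instance Definition _ := GRing.isMonoidMorphism.Build R A ain ain_monoid.
HB.instance Definition _ := GRing.isScalable.Build K R A *:%R ain ain_scalable.

Lemma ambiskew_rel :
  [/\ forall a, Xp * ain a = ain (sigma a) * Xp,
      forall a, Xm * ain a = ain (aut_inv sigma a) * Xm &
      Xp * Xm = ain h + xi *: (Xm * Xp)].
Proof. by split=> [a|a|]; solve_axiom; case: r. Qed.

Lemma ambiskew_ind (P : A -> Prop) :
  (forall a, P (ain a)) -> P Xp -> P Xm ->
  (forall x y, P x -> P y -> P (x + y)) ->
  (forall x y, P x -> P y -> P (x * y)) -> forall x, P x.
Proof.
move=> Pc Pp Pm PD PM x; rewrite (ambiskew_pi_repr x).
elim: (repr x) => [a|||e1 P1 e2 P2|e1 P1 e2 P2].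
- exact: Pc.
- exact: Pp.
- exact: Pm.
- have -> : \pi_A (AAdd e1 e2) = \pi_A e1 + \pi_A e2 by solve_axiom.
  exact: PD.
- have -> : \pi_A (AMul e1 e2) = \pi_A e1 * \pi_A e2 by solve_axiom.
  exact: PM.
Qed.

Section Lift.
Variables (B : algType K) (f : {lrmorphism R -> B}) (xp xm : B).
Hypothesis rel : ambiskew_relations f xp xm.

Lemma alift_in a : alift f xp xm (ain a) = f a.
Proof. exact: alift_pi. Qed.

Lemma alift_Xp : alift f xp xm Xp = xp.
Proof. exact: alift_pi. Qed.

Lemma alift_Xm : alift f xp xm Xm = xm.
Proof. exact: alift_pi. Qed.

Lemma aliftD : {morph alift f xp xm : x y / x + y}.
Proof. by move=> x y; rewrite alift_pi. Qed.

Lemma aliftM : {morph alift f xp xm : x y / x * y}.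
Proof. by move=> x y; rewrite alift_pi. Qed.

Lemma aliftZ c : {morph alift f xp xm : x / c *: x}.
Proof. by move=> x; rewrite alift_pi//= linearZ rmorph1 mulr_algl. Qed.

Lemma alift_unique (g : A -> B) :
  {morph g : x y / x + y} -> {morph g : x y / x * y} ->
  (forall a, g (ain a) = f a) -> g Xp = xp -> g Xm = xm ->
  g =1 alift f xp xm.
Proof.
move=> gD gM gin gp gm; elim/ambiskew_ind => [a||| x y IHx IHy|x y IHx IHy].
- by rewrite gin alift_in.
- by rewrite gp alift_Xp.
- by rewrite gm alift_Xm.
- by rewrite gD aliftD IHx IHy.
- by rewrite gM aliftM IHx IHy.
Qed.

End Lift.

End Ambiskew.

Definition is_ideal (R : pzRingType) (I : set R) : Prop :=
  [/\ I 0, forall a b, I a -> I b -> I (a + b) & forall a b, I b -> I (a * b)].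

Definition maximal_ideal (R : pzRingType) (m : set R) : Prop :=
  [/\ is_ideal m, ~ m 1 &
      forall J : set R, is_ideal J -> m `<=` J -> ~ J 1 -> J = m].

(* a(m): the scalar c with a - c in m (0 if there is none, which does not
   happen for a maximal ideal of a finitely generated algebra over an
   algebraically closed field) *)
Definition value_at (K : fieldType) (R : algType K) (a : R) (m : set R) : K :=
  xget 0 [set c : K | m (a - c%:A)].

Definition counit_ideal (K : fieldType) (R : algType K) (H : hopf_algebra R) :
    set R :=
  [set a | hcounit H a = 0].

Definition int_ideal (K : fieldType) (R : algType K) (H : hopf_algebra R)
    (sigma : alg_aut R) (n : int) : set R :=
  aut_iter sigma n @` counit_ideal H.

Definition internal_direct_sum (V : zmodType) (I : choiceType) (D : set I)
    (W : I -> set V) : Prop :=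
  (forall v : V, exists (s : seq I) (w : I -> V),
      (forall i, i \in s -> D i /\ W i (w i)) /\ v = \sum_(i <- s) w i) /\
  (forall (s : seq I) (w : I -> V), uniq s ->
      (forall i, i \in s -> D i /\ W i (w i)) ->
      \sum_(i <- s) w i = 0 -> forall i, i \in s -> w i = 0).

Definition submodule (A : pzRingType) (V : lmodType A) (N : set V) : Prop :=
  submod_closed (mem N).

Definition simple_submodule (A : pzRingType) (V : lmodType A) (N : set V) :
    Prop :=
  [/\ submodule N, N <> [set 0] &
      forall N' : set V, submodule N' -> N' `<=` N -> N' = [set 0] \/ N' = N].

Definition semisimple (A : pzRingType) (V : lmodType A) : Prop :=
  exists F : set (set V),
    (forall N, F N -> simple_submodule N) /\
    internal_direct_sum F (fun N : set V => N).

Section WeightModules.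
Variables (K : fieldType) (R : algType K).
Variables (sigma : alg_aut R) (h : R) (xi : K).
Local Notation A := (ambiskew sigma h xi).
Variable V : lmodType A.

Definition fin_dim : Prop :=
  exists (n : nat) (e : 'I_n -> V), forall v : V, exists c : 'I_n -> K,
    v = \sum_i (c i *: (1 : A)) *: e i.

Definition weight_space (m : set R) : set V :=
  [set v | forall a, m a -> (ain sigma h xi a : A) *: v = 0].

Definition weight_module : Prop :=
  internal_direct_sum (@maximal_ideal R) weight_space.

End WeightModules.

(* [None] stands for infinity. *)

Definition mul_order (K : fieldType) (q : K) : option nat :=
  if `[< exists2 n, (0 < n)%N & q ^+ n = 1 >]
  then Some (xget 0%N [set n | n.-primitive_root q]) else None.

Definition orderN (K : fieldType) (q : K) : option nat :=
  if q ^+ 2 == 1 then None else mul_order q.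

(* Main.v *)
Require Import Defs.
From HB Require Import structures.
From mathcomp Require Import all_boot all_order all_algebra.
From mathcomp Require Import boolp classical_sets.
From mathcomp Require Import ring.

(** Since [V] is finite-dimensional and [K] is algebraically closed, [R] acts on
every weight space through a character [chi].  For a highest weight vector [v]
one has [X+ X-^(n+1) v = c_(n+1) X-^n v] with
[c_(n+1) = chi (sigma^n h) + xi c_n].  The Hopf structure makes [r], [l] and [h]
span a [sigma]-stable space on which [sigma] is explicit, and [N = oo] together
with [h(1) <> 0] implies that [c_n = 0] for at most one [n > 0]; the same holds
for lowest weight vectors.  Uniqueness of the zero of [c] makes every highest
weight vector generate a simple module.  By induction on [k] with
[X+^k v = 0], every weight vector [v] is a sum of vectors [X-^i f_i] with [f_i]
of highest weight: subtracting suitable multiples of the [X-^(i+1) f_i] gives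
[X- X+ w = 0], and then [X+ w = 0], because otherwise the string through [w]
would yield two zeros of the lowest weight coefficients. *)

Set Implicit Arguments.
Unset Strict Implicit.
Unset Printing Implicit Defensive.

Import GRing.Theory.
Local Open Scope ring_scope.
Local Open Scope classical_set_scope.

(** * The coefficients of a string *)

(** In closed form this is the sum over [i < n] of [xi ^+ (n - 1 - i) * a i]. With [a i] the value
    of [h] at the [i]-th weight of a string, it is the factor gained when the [n]-th vector of the
    string is raised. *)
Fixpoint lowering_coef (K : fieldType) (xi : K) (a : nat -> K) (n : nat) : K :=
  if n is n'.+1 then a n' + xi * lowering_coef xi a n' else 0.

(** Index 0 is excluded because [lowering_coef] always vanishes there. *)
Definition at_most_one_zero (K : fieldType) (c : nat -> K) : Prop :=
  forall m n, (0 < m)%N -> (0 < n)%N -> c m = 0 -> c n = 0 -> m = n.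

Lemma lowering_coef_eq (K : fieldType) (xi : K) (a b : nat -> K) n :
  a =1 b -> lowering_coef xi a n = lowering_coef xi b n.
Proof. by move=> ab; elim: n => //= n ->; rewrite ab. Qed.

Section AtMostOneZero.
Variables (K : fieldType) (xi : K).
Hypotheses (charK : [pchar K] =i pred0) (xi_neq0 : xi != 0).

Lemma expf_inj_not_root (q : K) : q != 0 ->
  (forall n, (0 < n)%N -> q ^+ n != 1) -> injective (fun n => q ^+ n).
Proof.
move=> q0 qn.
have wlog_le m n : (m <= n)%N -> q ^+ m = q ^+ n -> m = n.
  move=> mn e; have [//|ltmn] := leqP n m; first by move=> nm; apply/eqP; rewrite eqn_leq mn.
  have := qn (n - m)%N; rewrite subn_gt0 => /(_ ltmn) /eqP[].
  by apply: (mulfI (expf_neq0 m q0)); rewrite -exprD subnKC// mulr1.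
by move=> m n e; case/orP: (leq_total m n) => /wlog_le; [exact|move/(_ (esym e))].
Qed.

(** Summing two geometric progressions gives the factorisation [cE]. For [n > 0] only its last
    factor can vanish, and it does so for at most one [n], since [p] is the inverse of [q] and the
    powers of [q] are distinct. *)
Lemma at_most_one_zero_q (q p kappa x y : K) :
  q * p = 1 -> q != 1 -> (forall n, (0 < n)%N -> q ^+ n != 1) ->
  kappa != 0 -> x != 0 ->
  at_most_one_zero
    (lowering_coef xi (fun n => kappa * xi ^+ n * (p ^+ n * x - q ^+ n * y))).
Proof.
move=> qp q1 qn k0 x0; set c := lowering_coef _ _.
have q0 : q != 0 by apply: contra_eq_neq qp => ->; rewrite mul0r eq_sym oner_eq0.
have qpn n : q ^+ n * p ^+ n = 1 by rewrite -exprMn qp expr1n.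
have cE n : (q - 1) * xi * c n
    = kappa * xi ^+ n * (q ^+ n - 1) * (q * p ^+ n * x - y).
  elim: n => [|n IH]; first by rewrite /c /= !expr0; ring.
  rewrite /= -/(c n) mulrDr [_ * (xi * _)]mulrCA IH !exprS.
    (* Both sides are regrouped to display the products [q * p] and [q ^+ n * p ^+ n], which are 1
       by hypotheses that [ring] cannot see. *)
    rewrite [RHS](_ : _ = kappa * (xi * xi ^+ n) * (q * (q * p) * (q ^+ n * p ^+ n) * x
     - (q * p) * p ^+ n * x - q * q ^+ n * y + y)); last by ring.
  rewrite [LHS](_ : _ = kappa * (xi * xi ^+ n) * (q * (q ^+ n * p ^+ n) * x
     - p ^+ n * x - q * q ^+ n * y + y)); last by ring.
  by rewrite qp qpn; ring.
have cz n : (0 < n)%N -> c n = 0 -> q * p ^+ n * x = y.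
  move=> n0 cn; apply/eqP; rewrite -subr_eq0; apply/eqP.
  have /eqP := cE n; rewrite cn mulr0 eq_sym !mulf_eq0 (negPf k0) expf_eq0.
  by rewrite (negPf xi_neq0) andbF subr_eq0 (negPf (qn _ n0)) /= => /eqP.
move=> m n m0 n0 /(cz _ m0) em /(cz _ n0); rewrite -em.
move=> /(mulIf x0) /(mulfI q0) e; apply: (expf_inj_not_root q0 qn).
by rewrite -[LHS]mulr1 -(qpn n) e mulrCA qpn mulr1.
Qed.

Lemma natr_eq0 n : (n%:R == 0 :> K) = (n == 0%N).
Proof. by move/(pcharf0P K): charK. Qed.

Lemma natr_inj_pchar0 : injective (fun n => n%:R : K).
Proof.
have le_inj m n : (m <= n)%N -> m%:R = n%:R :> K -> m = n.
  move=> mn /eqP; rewrite eq_sym -subr_eq0 -natrB// natr_eq0.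
  by rewrite subn_eq0 => nm; apply/eqP; rewrite eqn_leq mn.
by move=> m n e; case/orP: (leq_total m n) => /le_inj; [exact|move/(_ (esym e))].
Qed.

(** The progression is arithmetic up to powers of [xi], so for [n > 0] the coefficient vanishes only
    if an affine function of [n] with slope [y] does; characteristic zero then determines [n]. *)
Lemma at_most_one_zero_1 (x y : K) : y != 0 ->
  at_most_one_zero (lowering_coef xi (fun n => xi ^+ n * (x + n%:R * y))).
Proof.
move=> y0; set c := lowering_coef _ _.
have cE n : 2%:R * xi * c n = xi ^+ n * n%:R * (2%:R * x + (n%:R - 1) * y).
  elim: n => [|n IH]; first by rewrite /c /=; ring.
  by rewrite /= -/(c n) mulrDr [_ * (xi * _)]mulrCA IH !exprS -natr1; ring.
have cz n : (0 < n)%N -> c n = 0 -> n%:R * y = y - 2%:R * x.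
  move=> n0 cn; apply/eqP; rewrite -subr_eq0; apply/eqP.
  have /eqP := cE n; rewrite cn mulr0 eq_sym !mulf_eq0 expf_eq0.
  rewrite (negPf xi_neq0) andbF natr_eq0 (gtn_eqF n0) /= => /eqP <-.
  by ring.
move=> m n m0 n0 /(cz _ m0) em /(cz _ n0); rewrite -em => /(mulIf y0) e.
exact/natr_inj_pchar0/esym.
Qed.

(** By the closed form [cE], the coefficient at an even [n > 0] is a nonzero multiple of [n%:R * y],
    so it never vanishes; at odd [n] the condition is again affine in [n] with nonzero slope. *)
Lemma at_most_one_zero_N1 (x y : K) : y != 0 ->
  at_most_one_zero
    (lowering_coef xi (fun n => (- xi) ^+ n * (x + n%:R * y))).
Proof.
move=> y0; set c := lowering_coef _ _.
have cE n : 4%:R * xi * c n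
    = xi ^+ n * ((1 - (-1) ^+ n) * (2%:R * x - y) - 2%:R * n%:R * (-1) ^+ n * y).
  elim: n => [|n IH]; first by rewrite /c /=; ring.
  rewrite /= -/(c n) mulrDr [_ * (xi * _)]mulrCA IH [(- xi) ^+ n]exprNn.
  by rewrite !exprS -natr1; ring.
have cz n : (0 < n)%N -> c n = 0 -> n%:R * y = y - 2%:R * x.
  move=> n0 cn; have /eqP := cE n.
  have n2 : 2%:R != 0 :> K by rewrite natr_eq0.
  rewrite cn mulr0 eq_sym mulf_eq0 expf_eq0 (negPf xi_neq0) andbF /= -signr_odd.
  case: odd; rewrite /= ?expr0 ?expr1.
    rewrite (_ : _ - _ = 2%:R * (n%:R * y - (y - 2%:R * x))); last by ring.
    by rewrite mulf_eq0 (negPf n2) subr_eq0 => /eqP.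
  rewrite subrr mul0r sub0r oppr_eq0 mulr1 !mulf_eq0 (negPf n2) (negPf y0).
  by rewrite natr_eq0 (gtn_eqF n0).
move=> m n m0 n0 /(cz _ m0) em /(cz _ n0); rewrite -em => /(mulIf y0) e.
exact/natr_inj_pchar0/esym.
Qed.

End AtMostOneZero.

(** * Highest weight decomposition *)

Lemma iter_linearZ (K : fieldType) (V : lmodType K) (F : {linear V -> V}) n a v :
  iter n F (a *: v) = a *: iter n F v.
Proof. by elim: n => //= n ->; rewrite linearZZ. Qed.

Lemma iter_linear0 (K : fieldType) (V : lmodType K) (F : {linear V -> V}) n :
  iter n F 0 = 0.
Proof. by elim: n => //= n ->; rewrite linear0. Qed.

Section LoweringString.
Variables (K : fieldType) (V : lmodType K) (E F : {linear V -> V}).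
Variables (T : Type) (W : T -> V -> Prop) (dn : T -> T) (eta : T -> K) (xi : K).
Local Notation coef t := (lowering_coef xi (fun n => eta (iter n dn t))).
Hypothesis W_dn : forall t v, W t v -> W (dn t) (F v).
Hypothesis EF : forall t v, W t v -> E (F v) = eta t *: v + xi *: F (E v).
Hypothesis F_nilpotent : forall t v, W t v -> exists n, iter n F v = 0.
Hypothesis coef_zero : forall t v, W t v -> v != 0 -> at_most_one_zero (coef t).

Lemma weight_iter t v n : W t v -> W (iter n dn t) (iter n F v).
Proof. by move=> Wv; elim: n => //= n; exact: W_dn. Qed.

(** Only [F (E v) = 0] is assumed, not [E v = 0]: this starts the induction equally well, and
    [raise_eq0] needs this generality because there [E v = 0] is the goal. *)
Lemma raise_lowered t v n : W t v -> F (E v) = 0 ->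
  E (iter n.+1 F v) = coef t n.+1 *: iter n F v.
Proof.
move=> Wv FEv; elim: n => [|n IH].
  by rewrite /= (EF Wv) FEv !(scaler0, mulr0, addr0).
rewrite [LHS](EF (weight_iter n.+1 Wv)) IH linearZZ scalerA -scalerDl.
by [].
Qed.

(** Raising the vanishing vector just past the end of the string gives a multiple of its last
    nonzero vector, so the factor must be zero. *)
Lemma string_length t v : W t v -> F (E v) = 0 -> v != 0 ->
  exists n, [/\ coef t n.+1 = 0, iter n F v != 0 & iter n.+1 F v = 0].
Proof.
move=> Wv FEv v0; have [k] := F_nilpotent Wv.
elim: k => [/eqP|k IH Fk]; first by rewrite (negPf v0).
have [/IH //|Fk0] := eqVneq (iter k F v) 0.
exists k; split => //; have := raise_lowered k Wv FEv.
by rewrite Fk linear0 => /esym/eqP; rewrite scaler_eq0 (negPf Fk0) orbF => /eqP.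
Qed.

(** The string does end at some zero of the coefficients by [string_length], and there is only one
    such zero. *)
Lemma string_end t v n : W t v -> F (E v) = 0 -> coef t n.+1 = 0 ->
  iter n.+1 F v = 0.
Proof.
move=> Wv FEv cn; have [->|v0] := eqVneq v 0; first exact: iter_linear0.
have [m [cm _ Fm]] := string_length Wv FEv v0.
by rewrite (coef_zero Wv v0 _ _ cn cm).
Qed.

End LoweringString.

Section HighestWeightDecomposition.
Variables (K : fieldType) (V : lmodType K) (E F : {linear V -> V}).
Variables (T : Type) (W : T -> V -> Prop) (up dn : T -> T) (eta : T -> K).
Variable xi : K.
Local Notation coef t := (lowering_coef xi (fun n => eta (iter n dn t))).
Local Notation dual_coef t :=
  (lowering_coef xi^-1 (fun n => - xi^-1 * eta (iter n up t))).
Hypothesis xi_neq0 : xi != 0.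
Hypothesis upK : cancel up dn.
Hypothesis W0 : forall t, W t 0.
Hypothesis W_linear : forall t c u v, W t u -> W t v -> W t (c *: u + v).
Hypothesis W_up : forall t v, W t v -> W (up t) (E v).
Hypothesis W_dn : forall t v, W t v -> W (dn t) (F v).
Hypothesis EF : forall t v, W t v -> E (F v) = eta t *: v + xi *: F (E v).
Hypothesis E_nilpotent : forall t v, W t v -> exists n, iter n E v = 0.
Hypothesis F_nilpotent : forall t v, W t v -> exists n, iter n F v = 0.
Hypothesis coef_zero : forall t v, W t v -> v != 0 -> at_most_one_zero (coef t).
Hypothesis dual_coef_zero :
  forall t v, W t v -> v != 0 -> at_most_one_zero (dual_coef t).

(** Solving [EF] for [F (E v)] gives a relation of the same shape with [E] and [F] exchanged. Hence
    the results on lowering strings apply to raising strings, with coefficients [dual_coef]. *)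
Let FE t v : W t v -> F (E v) = (- xi^-1 * eta t) *: v + xi^-1 *: E (F v).
Proof.
move=> Wv; rewrite (EF Wv) scalerDr !scalerA mulVf// scale1r mulNr addrA.
by rewrite -scalerDl addNr scale0r add0r.
Qed.

(** Each step up multiplies by a coefficient of index between 1 and [n], which is nonzero because
    the only zero is at [n.+1]. *)
Lemma string_climb t w n i : W t w -> F (E w) = 0 -> w != 0 ->
  coef t n.+1 = 0 -> (i <= n)%N ->
  exists2 C, C != 0 & iter i E (iter n F w) = C *: iter (n - i) F w.
Proof.
move=> Ww FEw w0 cn; elim: i => [|i IH] lt_in.
  by exists 1; rewrite ?oner_eq0// subn0 scale1r.
have [C C0 Ei] := IH (ltnW lt_in).
exists (C * coef t (n - i)%N).
  rewrite mulf_neq0//; apply/eqP => ci.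
  have := coef_zero Ww w0 _ _ ci cn; rewrite subn_gt0 => /(_ lt_in isT).
  by move=> e; have := leq_subr i n; rewrite e ltnn.
rewrite /= Ei linearZZ -subSS subSn//.
by rewrite (raise_lowered W_dn EF _ Ww FEw) scalerA.
Qed.

(* Lowering [w] until its string ends at [z] and raising [z] back, the string
   of [z] would end both just above [w] and above [E w], unless [E w = 0]. *)
Lemma raise_eq0 t w : W t w -> F (E w) = 0 -> E w = 0.
Proof.
move=> Ww FEw; have [->|w0] := eqVneq w 0; first exact: linear0.
have [n [cn z0 Fz]] := string_length W_dn EF F_nilpotent Ww FEw w0.
have [C C0] := string_climb Ww FEw w0 cn (leqnn n); rewrite subnn /= => Ez.
have Wz := weight_iter W_dn n Ww.
have EFz : E (F (iter n F w)) = 0 by rewrite [F _]Fz linear0.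
(* Applying [F] to [E^(n+1) z = C E w] gives [C F (E w) = 0], while [raise_lowered] with [E] and [F]
   exchanged evaluates it as the dual coefficient times [C w]. *)
have dn0 : dual_coef (iter n dn t) n.+1 = 0.
  apply/eqP; have := raise_lowered W_up FE n Wz EFz.
  rewrite iterS Ez 2!linearZZ FEw scaler0 => /esym/eqP.
  by rewrite !scaler_eq0 (negPf C0) (negPf w0) !orbF.
have := string_end W_up FE E_nilpotent dual_coef_zero Wz EFz dn0.
by rewrite iterS Ez linearZZ => /eqP; rewrite scaler_eq0 (negPf C0) => /eqP.
Qed.

Lemma iter_upK t n : iter n dn (iter n up t) = t.
Proof. by elim: n => //= n IH; rewrite -iterS iterSr upK. Qed.

Lemma W_sum t (I : Type) (s : seq I) (f : I -> V) :
  (forall i, W t (f i)) -> W t (\sum_(i <- s) f i).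
Proof.
move=> Wf; elim: s => [|i s IH]; rewrite ?big_nil ?big_cons//.
by rewrite -[f i]scale1r; exact: W_linear.
Qed.

Lemma highest_weight_decomposition k t v : W t v -> iter k E v = 0 ->
  exists f : nat -> V, (forall i, W (iter i up t) (f i) /\ E (f i) = 0) /\
    v = \sum_(i < k) iter i F (f i).
Proof.
elim: k t v => [|k IH] t v Wv.
  move=> /= ->; exists (fun=> 0); split; last by rewrite big_ord0.
  by move=> i; rewrite linear0.
rewrite iterSr => /(IH _ _ (W_up Wv)) [f [fP Ev]].
have Wf i : W (iter i.+1 up t) (f i) by rewrite iterSr; case: (fP i).
have Ef i : F (E (f i)) = 0 by case: (fP i) => _ ->; rewrite linear0.
(* With this factor, [E] sends [a i *: iter i.+1 F (f i)] to [iter i F (f i)]. If the coefficient is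
   zero, then so is [a i], by the convention [0^-1 = 0]. *)
pose a i := (coef (iter i.+1 up t) i.+1)^-1.
pose w := v - \sum_(i < k) a i *: iter i.+1 F (f i).
have Ww : W t w.
  rewrite /w addrC -scaleN1r; apply: W_linear => //; apply: W_sum => i.
  rewrite -[_ *: _]addr0; apply: W_linear => //.
  by rewrite -{1}(iter_upK t i.+1); exact: (weight_iter W_dn).
have Ew : E w = 0.
  (* The terms with zero coefficient survive in [E w], but [F] kills them because their strings end
     there; so [F (E w) = 0] is what can be checked directly. *)
  apply: raise_eq0 Ww _.
  rewrite /w linearB Ev linear_sum -sumrB linear_sum big1// => i _.
  rewrite linearZZ (raise_lowered W_dn EF _ (Wf i) (Ef i)) scalerA.
  rewrite linearB linearZZ /a.
  have [c0|c0] := eqVneq (coef (iter i.+1 up t) i.+1) 0.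
    rewrite c0 mulr0 scale0r subr0.
    exact: (string_end W_dn EF F_nilpotent coef_zero (Wf i) (Ef i) c0).
  by rewrite mulVf// scale1r subrr.
(* The remainder [w] is the new vector of index 0; the vectors found for [E v] move up one index,
   since one more [F] is applied to them. *)
exists (fun i => if i is j.+1 then a j *: f j else w); split => [[|i]//|].
  split; first by rewrite -[_ *: _]addr0; apply: W_linear.
  by rewrite linearZZ; case: (fP i) => _ ->; rewrite scaler0.
rewrite big_ord_recl /=; under eq_bigr do rewrite -iterS iter_linearZ.
by rewrite subrK.
Qed.

End HighestWeightDecomposition.

(** * Sums of simple submodules *)

Section Semisimple.
Variables (A : pzRingType) (V : lmodType A).
Implicit Types (N M : set V) (l : seq (set V)).

Lemma submoduleP N : submodule N <->
  N 0 /\ forall a u v, N u -> N v -> N (a *: u + v).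
Proof.
split=> [[N0 NZ]|[N0 NZ]]; split.
- by move: N0; rewrite inE.
- by move=> a u v Nu Nv; have := NZ a u v (mem_set Nu) (mem_set Nv); rewrite inE.
- exact: mem_set.
- by move=> a u v; rewrite !inE; exact: NZ.
Qed.

Lemma submodule_sum N (I : Type) (s : seq I) (P : pred I) (f : I -> V) :
  submodule N -> (forall i, P i -> N (f i)) -> N (\sum_(i <- s | P i) f i).
Proof.
move=> /submoduleP[N0 NZ] Nf; elim/big_ind: _ => // u v Nu Nv.
by rewrite -[u]scale1r; exact: NZ.
Qed.

Definition independent l : Prop :=
  forall w : set V -> V, (forall N, N \in l -> N (w N)) ->
    \sum_(N <- l) w N = 0 -> forall N, N \in l -> w N = 0.

Definition sum_submodule l : set V :=
  [set v | exists2 w : set V -> V, forall N, N \in l -> N (w N) &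
    v = \sum_(N <- l) w N].

Lemma sum_submodule_submodule l :
  (forall N, N \in l -> submodule N) -> submodule (sum_submodule l).
Proof.
move=> sub; apply/submoduleP; split.
  exists (fun=> 0); last by rewrite big1.
  by move=> N /sub/submoduleP[].
move=> a _ _ [w wl ->] [w' wl' ->].
exists (fun N => a *: w N + w' N); last by rewrite big_split -scaler_sumr.
by move=> N lN; have /submoduleP[_ NZ] := sub N lN; apply: NZ; [exact: wl|exact: wl'].
Qed.

Lemma sub_sum_submodule l N : uniq l -> (forall M, M \in l -> submodule M) ->
  N \in l -> N `<=` sum_submodule l.
Proof.
move=> ul sub lN v Nv; exists (fun M => if M == N then v else 0).
  by move=> M lM; case: eqP => [->//|_]; have /submoduleP[] := sub M lM.
rewrite (bigD1_seq N)//= eqxx big1 ?addr0// => M /negPf.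
by move=> ->.
Qed.

Lemma simple_submoduleW N : simple_submodule N -> submodule N.
Proof. by case. Qed.

(** Greedy selection: a simple [N] meets the sum of the submodules already chosen either in 0, and
    is added, or in all of [N], and is redundant. *)
Lemma independent_simple_family l : (forall N, N \in l -> simple_submodule N) ->
  exists l', [/\ uniq l', forall N, N \in l' -> simple_submodule N,
    independent l' & forall N, N \in l -> N `<=` sum_submodule l'].
Proof.
elim: l => [|N l IH] sl; first by exists [::].
have [|l' [ul' sl' il' ll']] := IH.
  by move=> M lM; apply: sl; rewrite inE lM orbT.
have sub' M : M \in l' -> submodule M by move/sl'/simple_submoduleW.
have subS := sum_submodule_submodule sub'.
have [Nsub N0 Nsimple] := sl N (mem_head _ _).
have NZ := (submoduleP N).1 Nsub; have SZ := (submoduleP _).1 subS.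
case: (Nsimple (N `&` sum_submodule l')) => [||NS|NS].
- apply/submoduleP; split; first by split; [exact: NZ.1|exact: SZ.1].
  by move=> a u v [? ?] [? ?]; split; [exact: NZ.2|exact: SZ.2].
- by move=> v [].
- have lN : N \notin l'.
    apply/negP => lN; apply: N0; rewrite -NS setIidl//.
    exact: sub_sum_submodule.
  have sNl' M : M \in N :: l' -> simple_submodule M.
    by rewrite inE => /orP[/eqP ->|/sl' //]; exact: (sl N (mem_head _ _)).
  exists (N :: l'); split => //=; first by rewrite lN.
    move=> w wl; rewrite big_cons => w0.
    have wl' M : M \in l' -> M (w M) by move=> lM; apply: wl; rewrite inE lM orbT.
    have wN : w N = 0.
      have : (N `&` sum_submodule l') (w N).
        split; first exact: wl (mem_head _ _).
        (* In a vanishing sum, [w N] is minus the sum of the other terms, so it lies in the zero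
           intersection. *)
        have -> : w N = (-1) *: (\sum_(M <- l') w M) + 0.
          by rewrite scaleN1r addr0; apply/eqP; rewrite -addr_eq0 w0.
        by apply: SZ.2 => //; [exists w|exact: SZ.1].
      by rewrite NS.
    move: w0; rewrite wN add0r => /(il' _ wl') w0 M.
    by rewrite inE => /orP[/eqP ->|/w0].
  have sub M : M \in N :: l' -> submodule M by move/sNl'/simple_submoduleW.
  move=> M; rewrite inE => /orP[/eqP -> v Nv|/ll' Ml v /Ml [w wl ->]].
    by apply: (sub_sum_submodule _ sub) Nv; rewrite ?mem_head//= lN.
  rewrite big_seq; apply: submodule_sum; first exact: sum_submodule_submodule.
  move=> P lP; have lP' : P \in N :: l' by rewrite inE lP orbT.
  by apply: (sub_sum_submodule _ sub lP') (wl P lP); rewrite /= lN.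
- exists l'; split => // M; rewrite inE => /orP[/eqP -> v Nv|/ll' //].
  by move: Nv; rewrite -NS => -[].
Qed.

Lemma semisimple_of_simple_family l : (forall N, N \in l -> simple_submodule N) ->
  (forall M, submodule M -> (forall N, N \in l -> N `<=` M) -> M = setT) ->
  semisimple V.
Proof.
move=> sl lT; have [l' [ul' sl' il' ll']] := independent_simple_family sl.
have sub' M : M \in l' -> submodule M by move/sl'/simple_submoduleW.
have ST := lT _ (sum_submodule_submodule sub') ll'.
exists [set` l']; split => [N /sl' //|]; split => [v|s w us sw s0 N Ns].
  have : sum_submodule l' v by rewrite ST.
  by move=> [w wl ->]; exists l', w; split => // N lN; split=> //; exact: wl.
(* Independence of [l'] concerns families on all of [l'], so the family on the sublist [s] is
   extended by 0. *)
pose w' M := if M \in s then w M else 0.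
have -> : w N = w' N by rewrite /w' Ns.
apply: il'; last by case: (sw N Ns).
  move=> M lM; rewrite /w'; case: ifP => [/sw[]//|_].
  by have /submoduleP[] := sub' M lM.
rewrite -[RHS]s0 /w' -big_mkcond -big_filter; apply: perm_big.
apply: uniq_perm => //; first exact: filter_uniq.
by move=> M; rewrite mem_filter; case: (boolP (M \in s)) => //= /sw[].
Qed.

(** Membership in a finite sum of simple submodules, phrased through all submodules containing them
    so that no decomposition of [v] has to be carried along. *)
Definition in_simple_sum (v : V) : Prop :=
  exists2 l : seq (set V), forall N, N \in l -> simple_submodule N &
    forall M, submodule M -> (forall N, N \in l -> N `<=` M) -> M v.

Lemma in_simple_sum_simple N v : simple_submodule N -> N v -> in_simple_sum v.
Proof.
move=> sN Nv; exists [:: N] => [M|M _ /(_ N (mem_head _ _))]; last exact.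
by rewrite inE => /eqP ->.
Qed.

Lemma in_simple_sum0 : in_simple_sum 0.
Proof. by exists [::] => // M /submoduleP[]. Qed.

Lemma in_simple_sum_sum (I : Type) (s : seq I) (P : pred I) (f : I -> V) :
  (forall i, P i -> in_simple_sum (f i)) -> in_simple_sum (\sum_(i <- s | P i) f i).
Proof.
move=> Pf; elim/big_ind: _ => // [|u v [l sl lu] [l' sl' lv]].
  exact: in_simple_sum0.
exists (l ++ l') => [N|M sM lM]; first by rewrite mem_cat => /orP[/sl|/sl'].
rewrite -[u]scale1r; apply: ((submoduleP M).1 sM).2.
  by apply: lu => // N lN; apply: lM; rewrite mem_cat lN.
by apply: lv => // N lN; apply: lM; rewrite mem_cat lN orbT.
Qed.

Lemma semisimple_of_generators n (e : 'I_n -> V) :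
  (forall M, submodule M -> (forall i, M (e i)) -> M = setT) ->
  (forall i, in_simple_sum (e i)) -> semisimple V.
Proof.
move=> eT /(_ _)/cid2-/all_sig2[l sl le].
apply: (@semisimple_of_simple_family (flatten [seq l i | i <- enum 'I_n])).
  by move=> N /flatten_mapP[i _]; exact: sl.
move=> M sM lM; apply: eT => // i; apply: le => // N lN; apply: lM.
by apply/flatten_mapP; exists i => //; rewrite mem_enum.
Qed.

End Semisimple.

(** * Weight vectors of an ambiskew module *)

Section RestrictScalars.
Variables (K : fieldType) (R : algType K) (sigma : alg_aut R) (h : R) (xi : K).
Local Notation A := (ambiskew sigma h xi).
Variable V : lmodType A.

(** An alias of [V] that carries the [K]-vector space structure obtained by restricting scalars from
    [A], while [V] keeps its [A]-module structure. *)
Definition scalars_restricted : Type := V.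
Local Notation VK := scalars_restricted.

HB.instance Definition _ := GRing.Zmodule.copy VK V.

Definition restricted_scale (c : K) (v : VK) : VK := (c *: (1 : A)) *: (v : V).

Lemma restricted_scaleA a b v :
  restricted_scale a (restricted_scale b v) = restricted_scale (a * b) v.
Proof.
by rewrite /restricted_scale scalerA -ambiskew_scalerAl mul1r scalerA.
Qed.

Lemma restricted_scale1 : left_id 1 restricted_scale.
Proof. by move=> v; rewrite /restricted_scale !scale1r. Qed.

Lemma restricted_scaleDr : right_distributive restricted_scale +%R.
Proof. by move=> c u v; exact: (scalerDr (c *: (1 : A)) (u : V) v). Qed.

Lemma restricted_scaleDl v : {morph restricted_scale^~ v : a b / a + b}.
Proof.
move=> a b; rewrite /restricted_scale scalerDl.
exact: (scalerDl (v : V) (a *: (1 : A)) (b *: (1 : A))).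
Qed.

HB.instance Definition _ := GRing.Zmodule_isLmodule.Build K VK
  restricted_scaleA restricted_scale1 restricted_scaleDr restricted_scaleDl.

Definition act (x : A) (v : VK) : VK := x *: (v : V).

Lemma act_linear x : linear (act x).
Proof.
move=> c u v; rewrite /act [LHS](scalerDr x (restricted_scale c u : V) v).
congr (_ + _); rewrite [LHS]scalerA [RHS]scalerA.
by rewrite -ambiskew_scalerAr -ambiskew_scalerAl mulr1 mul1r.
Qed.

HB.instance Definition _ x := GRing.isLinear.Build K VK VK *:%R (act x)
  (act_linear x).

Lemma act_scale x c v : act x (c *: v) = c *: act x v.
Proof. exact: linearZZ. Qed.

Lemma actM x y v : act (x * y) v = act x (act y v).
Proof. by rewrite /act scalerA. Qed.

Lemma actD x y v : act (x + y) v = act x v + act y v.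
Proof. exact: (scalerDl (v : V) x y). Qed.

Lemma actZ c x v : act (c *: x) v = c *: act x v.
Proof.
by rewrite -[x in LHS]mul1r ambiskew_scalerAl [LHS]actM.
Qed.

Lemma act1 v : act 1 v = v.
Proof. exact: (scale1r (v : V)). Qed.

Lemma act_suml (I : Type) (s : seq I) (x : I -> A) v :
  act (\sum_(i <- s) x i) v = \sum_(i <- s) act (x i) v.
Proof.
by apply: (big_morph (act^~ v)) => [y z|]; [exact: actD|exact: (scale0r (v : V))].
Qed.

End RestrictScalars.

(** * Characters of [R] and their kernels *)

Section Characters.
Variables (K : fieldType) (R : algType K).

Definition is_character (chi : R -> K) : Prop :=
  [/\ chi 1 = 1, {morph chi : a b / a * b} & scalar chi].

Lemma is_character_comp (f : {lrmorphism R -> R}) chi :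
  is_character chi -> is_character (chi \o f).
Proof.
move=> [chi1 chiM chiL]; split => [|a b|c a b] /=; first by rewrite rmorph1.
  by rewrite rmorphM chiM.
by rewrite linearP chiL.
Qed.

Definition char_ker (chi : R -> K) : set R := [set a | chi a = 0].

Lemma char_ker_maximal chi : is_character chi -> maximal_ideal (char_ker chi).
Proof.
move=> [chi1 chiM chiL].
have chi0 : chi 0 = 0 by have := chiL (-1) 0 0; rewrite scaler0 addr0 mulN1r addNr.
have chiD a b : chi (a + b) = chi a + chi b.
  by rewrite -[a]scale1r chiL scale1r mul1r.
have chiZ c a : chi (c *: a) = c * chi a by rewrite -[_ *: _]addr0 chiL chi0 addr0.
split; rewrite /char_ker.
- split => [//|a b /= a0 b0|a b /= b0]; first by rewrite chiD a0 b0 addr0.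
  by rewrite chiM b0 mulr0.
- by rewrite /= chi1; apply/eqP; exact: oner_neq0.
move=> J [J0 JD JM] kerJ J1; apply/seteqP; split => // a Ja.
apply: contrapT => /eqP chia; apply: J1.
(* This multiple of [a] lies in [J] and has character value 1, so [1 - b] is in the kernel and [J]
   contains 1. *)
pose b := ((chi a)^-1 *: 1) * a.
have chib : chi b = 1 by rewrite /b chiM chiZ chi1 mulr1 mulVf.
rewrite -(subrK b 1); apply: JD; last exact: JM.
apply: kerJ => /=; rewrite -scaleN1r addrC chiL chib chi1.
by rewrite mulr1 addNr.
Qed.

End Characters.

Lemma is_character_iter (K : fieldType) (R : algType K) (g : {lrmorphism R -> R})
    (chi : R -> K) n : is_character chi -> is_character (chi \o iter n g).
Proof.
move=> chiC; elim: n => // n /(is_character_comp g); congr is_character.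
by apply/funext => a /=; rewrite -iterSr.
Qed.

(** For [i < j], the map [f^(j-i)] carries the kernel of index [i] onto that of index [j]. Equal
    kernels would give a maximal ideal fixed by a positive iterate of [f]. *)
Lemma char_ker_iter_inj (K : fieldType) (R : algType K) (f g : {lrmorphism R -> R})
    (chi : R -> K) : cancel f g -> cancel g f ->
  (forall n m, (0 < n)%N -> maximal_ideal m -> iter n f @` m <> m) ->
  is_character chi -> injective (fun n => char_ker (chi \o iter n g)).
Proof.
move=> fgK gfK tf chiC.
have iterK n : cancel (iter n f) (iter n g).
  by elim: n => // n IH a; rewrite iterSr iterS fgK IH.
have iterKV n : cancel (iter n g) (iter n f).
  by elim: n => // n IH a; rewrite iterSr iterS gfK IH.
have lt_neq i j : (i < j)%N ->
    char_ker (chi \o iter i g) <> char_ker (chi \o iter j g).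
  move=> ij e; apply: (tf (j - i)%N _ _ (char_ker_maximal (is_character_iter g i chiC))).
    by rewrite subn_gt0.
  rewrite [RHS]e; apply/seteqP; split => [_ [a ia <-]|a].
    by rewrite /char_ker /= -{1}(subnKC (ltnW ij)) iterD iterK.
  rewrite /char_ker /= -{1}(subnKC (ltnW ij)) iterD => ja.
  by exists (iter (j - i) g a); [exact: ja|exact: iterKV].
move=> i j e; have [ij|ij|//] := ltngtP i j.
  by case: (lt_neq _ _ ij).
by case: (lt_neq _ _ ij).
Qed.

Section WeightVectors.
Variables (K : fieldType) (R : algType K) (sigma : alg_aut R) (h : R) (xi : K).
Local Notation A := (ambiskew sigma h xi).
Variable V : lmodType A.
Local Notation VK := (scalars_restricted V).
Local Notation ain := (ain sigma h xi).
Local Notation E := (act (Xp sigma h xi) : VK -> VK).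
Local Notation F := (act (Xm sigma h xi) : VK -> VK).

Definition weight_vector (chi : R -> K) (v : VK) : Prop :=
  forall a, act (ain a) v = chi a *: v.

Lemma weight_vector0 chi : weight_vector chi 0.
Proof. by move=> a; rewrite linear0 scaler0. Qed.

Lemma weight_vector_linear chi c u v :
  weight_vector chi u -> weight_vector chi v -> weight_vector chi (c *: u + v).
Proof.
by move=> Wu Wv a; rewrite act_linear Wu Wv scalerDr !scalerA mulrC.
Qed.

Lemma weight_vector_up chi v :
  weight_vector chi v -> weight_vector (chi \o aut_inv sigma) (E v).
Proof.
have [XpR _ _] := ambiskew_rel sigma h xi.
move=> Wv a; rewrite -{1}(autVK sigma a) -actM -XpR actM Wv.
by rewrite linearZZ.
Qed.

Lemma weight_vector_down chi v :
  weight_vector chi v -> weight_vector (chi \o sigma) (F v).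
Proof.
have [_ XmR _] := ambiskew_rel sigma h xi.
move=> Wv a; rewrite -{1}(autK sigma a) -actM -XmR actM Wv.
by rewrite linearZZ.
Qed.

Lemma weight_vector_EF chi v : weight_vector chi v ->
  E (F v) = chi h *: v + xi *: F (E v).
Proof.
have [_ _ XpXm] := ambiskew_rel sigma h xi.
by move=> Wv; rewrite -actM XpXm actD Wv actZ actM.
Qed.

Lemma weight_vector_character chi v : weight_vector chi v -> v != 0 ->
  is_character chi.
Proof.
move=> Wv v0.
have scale_inj : injective (fun c : K => c *: v).
  move=> c d /eqP; rewrite -subr_eq0 -scalerBl scaler_eq0 (negPf v0) orbF.
  by rewrite subr_eq0 => /eqP.
split.
- by apply: scale_inj; rewrite -Wv rmorph1 act1 scale1r.
- move=> a b; apply: scale_inj; rewrite -Wv rmorphM actM Wv act_scale Wv.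
  by rewrite scalerA mulrC.
- move=> c a b; apply: scale_inj; rewrite -Wv linearP actD actZ !Wv.
  by rewrite scalerA scalerDl.
Qed.

Lemma weight_vector_space chi v : weight_vector chi v ->
  weight_space (char_ker chi) (v : V).
Proof.
by move=> Wv a chia; rewrite [LHS](Wv a) chia scale0r.
Qed.

Lemma fin_dim_dependent : fin_dim V ->
  exists n, forall u : nat -> VK, exists a : 'I_n.+1 -> K,
    (exists i, a i != 0) /\ \sum_(i < n.+1) a i *: u i = 0.
Proof.
move=> [n [e eV]]; exists n => u.
have /boolp.choice[C uC] i : exists c : 'I_n -> K, u i = \sum_j c j *: (e j : VK).
  exact: eV.
pose M := \matrix_(i < n.+1, j < n) C i j.
have : kermx M != 0.
  rewrite kermx_eq0 /row_free neq_ltn.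
  by rewrite (leq_ltn_trans (rank_leq_col M)).
move=> /rowV0Pn[a /sub_kermxP aM a0].
exists (a 0); split.
  apply: contrapT => /forallNP a0'; move/eqP: a0; apply; apply/rowP => i.
  by rewrite mxE; apply/eqP/negPn/negP => /(a0' i).
under eq_bigr do rewrite uC scaler_sumr.
rewrite exchange_big big1// => j _ /=.
under eq_bigr do rewrite scalerA.
rewrite -scaler_suml; have /matrixP/(_ 0 j) := aM.
rewrite !mxE; under eq_bigr do rewrite mxE.
by move=> ->; rewrite scale0r.
Qed.

(** The first [n + 1] vectors are linearly dependent, and directness of the weight decomposition
    kills every term of the relation, in particular one with nonzero coefficient. *)
Lemma weights_finite : fin_dim V -> weight_module V ->
  exists n, forall (m : nat -> set R) (u : nat -> VK), injective m ->
    (forall i, maximal_ideal (m i) /\ weight_space (m i) (u i : V)) ->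
    exists2 i, (i <= n)%N & u i = 0.
Proof.
move=> /fin_dim_dependent[n nP] [_ Vind]; exists n => m u mI mu.
have [a [[i ai] sum0]] := nP u.
pose s := [seq m j | j <- iota 0 n.+1].
(* [internal_direct_sum] indexes families by the ideals themselves, so the position of [p] is
   recovered with [index]; this is consistent because [m] is injective. *)
pose w (p : set R) : VK := a (inord (index p s)) *: u (index p s).
have wE (j : 'I_n.+1) : w (m j) = a j *: u j.
  have -> : w (m j) = a (inord j) *: u j.
    rewrite /w index_map// -[X in index X](add0n j).
    by rewrite -[X in index X](nth_iota 0 0 (ltn_ord j)) index_uniq ?size_iota ?iota_uniq.
  by rewrite inord_val.
have ws p : p \in s -> maximal_ideal p /\ weight_space p (w p : V).
  move=> /mapP[j]; rewrite mem_iota add0n => /andP[_ jn] ->.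
  rewrite (wE (Ordinal jn)); split; first exact: (mu j).1.
  by move=> b mb; rewrite [LHS]act_scale [act _ _]((mu j).2 b mb) scaler0.
exists i; first by rewrite -ltnS.
have wi : w (m i) = 0.
  apply: (Vind s w _ ws).
  - by rewrite map_inj_uniq// iota_uniq.
  - rewrite -[RHS]sum0 big_map -[iota _ _]/(index_iota 0 n.+1) big_mkord.
    by apply: eq_bigr => j _; exact: wE.
  - by rewrite map_f// mem_iota /= add0n ltn_ord.
by move/eqP: wi; rewrite wE scaler_eq0 (negPf ai) => /eqP.
Qed.

(** The iterates on [v] have weights with pairwise distinct kernels, so by [weights_finite] one of
    them vanishes. Keeping [f], [g] and [x] general covers both [X+] and [X-]. *)
Lemma act_nilpotent (f g : {lrmorphism R -> R}) (x : A) : cancel f g ->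
  cancel g f ->
  (forall n m, (0 < n)%N -> maximal_ideal m -> iter n f @` m <> m) ->
  (forall chi v, weight_vector chi v -> weight_vector (chi \o g) (act x v)) ->
  fin_dim V -> weight_module V ->
  forall chi v, weight_vector chi v -> exists n, iter n (act x : VK -> VK) v = 0.
Proof.
move=> fK gK tf Wx Vf Vw chi v Wv.
have [->|v0] := eqVneq v 0; first by exists 0%N.
have chiC := weight_vector_character Wv v0.
have Wi i : weight_vector (chi \o iter i g) (iter i (act x : VK -> VK) v).
  elim: i => // i /Wx; congr weight_vector.
  by apply/funext => a /=; rewrite -iterSr.
have [n /(_ _ (fun i => iter i (act x : VK -> VK) v)) nP] := weights_finite Vf Vw.
have [i|i _ i0] := nP _ (char_ker_iter_inj fK gK tf chiC); last by exists i.
split; last exact: weight_vector_space.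
exact/char_ker_maximal/is_character_iter.
Qed.

End WeightVectors.

Lemma annihilator_maximal (K : fieldType) (R : comUnitAlgType K)
    (sigma : alg_aut R) (h : R) (xi : K) (V : lmodType (ambiskew sigma h xi))
    (m : set R) (u : V) :
  maximal_ideal m -> weight_space m u -> u != 0 ->
  [set a | (ain sigma h xi a : ambiskew sigma h xi) *: u = 0] = m.
Proof.
move=> [_ _ mmax] mu u0; apply: mmax => //; last first.
  by rewrite /= rmorph1 scale1r; apply/eqP.
split=> [|a b /= a0 b0|a b /= b0].
- by rewrite /= rmorph0 scale0r.
- by rewrite rmorphD scalerDl a0 b0 addr0.
- by rewrite rmorphM -scalerA b0 scaler0.
Qed.

(* Finite dimension replaces the Nullstellensatz: [a] is algebraic on [v], so
   some [a - c] is not injective on the weight space, hence lies in [m]. *)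
Lemma weight_space_character (K : closedFieldType) (R : comUnitAlgType K)
    (sigma : alg_aut R) (h : R) (xi : K) (V : lmodType (ambiskew sigma h xi))
    (m : set R) (v : scalars_restricted V) :
  fin_dim V -> maximal_ideal m -> weight_space m (v : V) ->
  exists chi, weight_vector chi v.
Proof.
move=> /fin_dim_dependent[n nP] mmax mv.
have [->|v0] := eqVneq v 0; first by exists (fun=> 0); exact: weight_vector0.
suff /boolp.choice[chi chiP] : forall a, exists c, act (ain sigma h xi a) v = c *: v.
  by exists chi.
move=> a; suff [c mc] : exists c, m (a - c%:A).
  exists c; have /eqP := mv _ mc; rewrite -[_ *: _]/(act _ v).
  rewrite linearB -scaleN1r actD actZ scaleN1r subr_eq0 => /eqP ->.
  by rewrite linearZZ actZ rmorph1 act1.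
have [b [[i bi] b0]] := nP (fun i => act (ain sigma h xi (a ^+ i)) v).
pose p := \poly_(i < n.+1) b (inord i).
have p0 : p != 0.
  apply/eqP => /(congr1 (fun q : {poly K} => q`_i)).
  by rewrite coef_poly ltn_ord inord_val coef0; apply/eqP.
have pa : act (ain sigma h xi (horner_alg a p)) v = 0.
  rewrite -[RHS]b0 /p poly_def !linear_sum act_suml; apply: eq_bigr => j _ /=.
  by rewrite linearZ /= mulr_algl rmorphXn /= horner_algX linearZ actZ inord_val.
have [rs pE] := closed_field_poly_normal p.
have {pa} : act (ain sigma h xi (\prod_(z <- rs) (a - z%:A))) v = 0.
  move/eqP: pa; rewrite pE linearZ /= mulr_algl linearZ actZ scaler_eq0 lead_coef_eq0 (negPf p0).
  rewrite rmorph_prod; under eq_bigr do rewrite rmorphB /= horner_algX horner_algC.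
  by move/eqP.
(* Linear factors are removed until the remaining product [u] acting on [v] is nonzero. Then [a - z]
   kills [u], whose annihilator is exactly [m]. *)
elim: rs {pE} => [|z rs IH].
  by rewrite big_nil rmorph1 act1 => /eqP; rewrite (negPf v0).
rewrite big_cons rmorphM actM.
set u := act _ v => zu; have [/IH //|u0] := eqVneq u 0.
exists z; rewrite -(annihilator_maximal (u := u) mmax) // => d md.
rewrite [LHS](_ : _ = act (ain sigma h xi d) u)// /u -actM -rmorphM mulrC.
rewrite rmorphM actM (_ : act _ v = 0) ?linear0//.
exact: mv.
Qed.

(** * Highest weight modules *)

Section HighestWeightModule.
Variables (K : fieldType) (R : algType K) (sigma : alg_aut R) (h : R) (xi : K).
Local Notation A := (ambiskew sigma h xi).
Variable V : lmodType A.
Local Notation VK := (scalars_restricted V).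
Local Notation E := (act (Xp sigma h xi) : VK -> VK).
Local Notation F := (act (Xm sigma h xi) : VK -> VK).
Variables (chi : R -> K) (v : VK) (n : nat).
Local Notation coef := (lowering_coef xi (fun i => chi (iter i sigma h))).
Hypothesis Wv : weight_vector chi v.
Hypothesis Ev : E v = 0.
Hypothesis coef_neq0 : forall i, (0 < i <= n)%N -> coef i != 0.
Hypothesis Fv : iter n.+1 F v = 0.

Definition string_span (k : nat) (u : VK) : Prop :=
  exists c : nat -> K, u = \sum_(i < k) c i *: iter i F v.

Lemma string_span_linear k a u w :
  string_span k u -> string_span k w -> string_span k (a *: u + w).
Proof.
move=> [c ->] [d ->]; exists (fun i => a * c i + d i).
rewrite scaler_sumr -big_split; apply: eq_bigr => i _ /=.
by rewrite scalerDl scalerA.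
Qed.

Lemma string_span0 k : string_span k 0.
Proof. by exists (fun=> 0); rewrite big1// => i _; rewrite scale0r. Qed.

Lemma string_spanZ k a u : string_span k u -> string_span k (a *: u).
Proof.
by move=> uS; rewrite -[_ *: _]addr0; exact: string_span_linear (string_span0 k).
Qed.

Lemma string_span_iter i : string_span n.+1 (iter i F v).
Proof.
have [lt_in|le_ni] := ltnP i n.+1.
  exists (fun j => (j == i)%:R); rewrite (bigD1 (Ordinal lt_in))//= eqxx scale1r.
  rewrite big1 ?addr0// => j ji.
  by rewrite (_ : (j == i :> nat) = false) ?scale0r//; exact/negbTE.
rewrite -(subnK le_ni) iterD Fv iter_linear0; exact: string_span0.
Qed.

Lemma weight_string i : weight_vector (chi \o iter i sigma) (iter i F v).
Proof.
elim: i => // i /weight_vector_down; congr weight_vector.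
by apply/funext => a /=; rewrite -iterSr.
Qed.

Lemma raise_string i : E (iter i.+1 F v) = coef i.+1 *: iter i F v.
Proof.
elim: i => [|i IH].
  by rewrite /= (weight_vector_EF Wv) Ev linear0 !(scaler0, mulr0, addr0).
rewrite [LHS](weight_vector_EF (weight_string i.+1)) IH act_scale scalerA.
by rewrite -scalerDl.
Qed.

(** It is enough to treat the generators: [R] acts by scalars on each string vector, [X+] steps down
    one index, and [X-] steps up one, reaching 0 at [n.+1]. *)
Lemma string_span_act x u : string_span n.+1 u -> string_span n.+1 (act x u).
Proof.
have spanW y : (forall i, string_span n.+1 (act y (iter i F v))) ->
    forall w, string_span n.+1 w -> string_span n.+1 (act y w).
  move=> yS w [c ->]; rewrite linear_sum.
  elim/big_ind: _ => [|w1 w2|i _]; first exact: string_span0.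
    by rewrite -{2}[w1]scale1r; exact: string_span_linear.
  by rewrite linearZZ; apply: string_spanZ; exact: yS.
move: u; elim/ambiskew_ind: x => [a||| x y IHx IHy|x y IHx IHy] u.
- apply: (spanW) u => i; rewrite weight_string; apply: string_spanZ.
  exact: string_span_iter.
- apply: (spanW) u => -[|i]; first by rewrite Ev; exact: string_span0.
  by rewrite raise_string; apply: string_spanZ; exact: string_span_iter.
- by apply: (spanW) u => i; exact: (string_span_iter i.+1).
- move=> uS; rewrite actD -[act x u]scale1r.
  by apply: string_span_linear; [exact: IHx|exact: IHy].
- by move=> uS; rewrite actM; apply: IHx; exact: IHy.
Qed.

(** Applying [E] removes the term in [v] and shifts the others down, multiplying them by nonzero
    coefficients. After [k] applications only a nonzero multiple of [v] is left. *)
Lemma highest_weight_vector_mem (N : set V) (c : nat -> K) k : submodule N ->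
  (k <= n)%N -> c k != 0 -> N (\sum_(i < k.+1) c i *: iter i F v) -> N v.
Proof.
move=> /submoduleP[N0 NZ]; elim: k c => [|k IH] c kn ck Nu.
  rewrite -[v](scalerK ck) -[_ *: (_ *: _)]addr0; apply: NZ => //.
  by move: Nu; rewrite big_ord1.
apply: (IH (fun i => c i.+1 * coef i.+1)); first exact: ltnW.
  by rewrite mulf_neq0// coef_neq0.
rewrite -[X in N X]addr0.
rewrite (_ : \sum_(i < _) _ = E (\sum_(i < k.+2) c i *: iter i F v)).
  exact: NZ.
rewrite linear_sum [RHS]big_ord_recl linearZZ /= Ev scaler0 add0r.
by apply: eq_bigr => i _; rewrite linearZZ -scalerA; congr (_ *: _); exact/esym/raise_string.
Qed.

Lemma highest_weight_vector_mem_span (N : set V) u : submodule N -> u != 0 ->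
  string_span n.+1 u -> N u -> N v.
Proof.
move=> sN u0 [c uE]; move: u0; rewrite {}uE.
have : (n.+1 <= n.+1)%N by [].
elim: {-2}n.+1 => [|k IH] kn; first by rewrite big_ord0 eqxx.
have [ck|ck _] := eqVneq (c k) 0.
  by rewrite big_ord_recr /= ck scale0r addr0; apply: IH; exact: ltnW.
exact: (highest_weight_vector_mem sN kn ck).
Qed.

Lemma highest_weight_module_simple : v != 0 ->
  simple_submodule [set u : V | exists x : A, u = x *: (v : V)].
Proof.
move=> v0; set M := [set u | _].
have Mv : M v by exists 1; rewrite scale1r.
split=> [|M0|N sN NM].
- apply/submoduleP; split; first by exists 0; rewrite scale0r.
  by move=> a _ _ [x ->] [y ->]; exists (a * x + y); rewrite scalerDl scalerA.
- by move: Mv; rewrite M0 => /eqP; rewrite (negPf v0).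
have [N0 NZ] := (submoduleP N).1 sN.
have [[u [Nu u0]]|Nu] := pselect (exists u, N u /\ u != 0); [right|left].
  apply/seteqP; split => // _ [x ->].
  rewrite -[x *: _]addr0; apply: NZ => //.
  apply: (highest_weight_vector_mem_span (u := u)) => //.
  have [x' ->] := NM _ Nu; exact: (string_span_act x' (string_span_iter 0)).
apply/seteqP; split => [u Nu'|_ ->//].
by apply: contrapT => /eqP u0; apply: Nu; exists u.
Qed.

End HighestWeightModule.

(** * Semisimplicity from the zeros of the coefficients *)

Section SemisimplicityCriterion.
Variables (K : closedFieldType) (R : comUnitAlgType K).
Variables (sigma : alg_aut R) (h : R) (xi : K).
Variable V : lmodType (ambiskew sigma h xi).
Local Notation VK := (scalars_restricted V).
Local Notation E := (act (Xp sigma h xi) : VK -> VK).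
Local Notation F := (act (Xm sigma h xi) : VK -> VK).

Lemma weight_module_semisimple :
  xi != 0 ->
  (forall (n : int) (m : set R), n != 0 -> maximal_ideal m ->
     aut_iter sigma n @` m <> m) ->
  (forall chi, is_character chi ->
     at_most_one_zero (lowering_coef xi (fun i => chi (iter i sigma h)))) ->
  (forall chi, is_character chi ->
     at_most_one_zero (lowering_coef xi^-1
       (fun i => - xi^-1 * chi (iter i (aut_inv sigma) h)))) ->
  fin_dim V -> weight_module V -> semisimple V.
Proof.
move=> xi0 tf coefP dual_coefP Vf Vw.
pose up (chi : R -> K) := chi \o aut_inv sigma; pose dn (chi : R -> K) := chi \o sigma.
have tf_up n m : (0 < n)%N -> maximal_ideal m -> iter n sigma @` m <> m.
  by move=> n0; apply: (tf n%:Z); case: n n0.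
have tf_dn n m : (0 < n)%N -> maximal_ideal m -> iter n (aut_inv sigma) @` m <> m.
  by case: n => // n _; exact: (tf (Negz n)).
have Enil := act_nilpotent (autK sigma) (autVK sigma) tf_up
  (@weight_vector_up _ _ _ _ _ V) Vf Vw.
have Fnil := act_nilpotent (autVK sigma) (autK sigma) tf_dn
  (@weight_vector_down _ _ _ _ _ V) Vf Vw.
have upE chi n : iter n up chi = chi \o iter n (aut_inv sigma).
  by elim: n => //= n ->; apply/funext => a; rewrite /up /= -iterSr.
have dnE chi n : iter n dn chi = chi \o iter n sigma.
  by elim: n => //= n ->; apply/funext => a; rewrite /dn /= -iterSr.
have coef_zero chi (v : VK) : weight_vector chi v -> v != 0 ->
    at_most_one_zero (lowering_coef xi (fun n => iter n dn chi h)).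
  move=> Wv v0; under [fun n => _]funext => n do rewrite dnE.
  exact: coefP (weight_vector_character Wv v0).
have dual_coef_zero chi (v : VK) : weight_vector chi v -> v != 0 ->
    at_most_one_zero (lowering_coef xi^-1 (fun n => - xi^-1 * iter n up chi h)).
  move=> Wv v0; under [fun n => _]funext => n do rewrite upE.
  exact: dual_coefP (weight_vector_character Wv v0).
have upK : cancel up dn.
  by move=> chi; apply/funext => a; rewrite /up /dn /= autK.
have simpleF (f : VK) chi i : weight_vector chi f -> E f = 0 ->
    in_simple_sum (iter i F f : V).
  move=> Wf Ef; have [->|f0] := eqVneq f 0.
    rewrite iter_linear0; exact: in_simple_sum0.
  have FEf : F (E f) = 0 by rewrite Ef linear0.
  have [n [cn _ Fn]] := string_length (@weight_vector_down _ _ _ _ _ V)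
    (@weight_vector_EF _ _ _ _ _ V) Fnil Wf FEf f0.
  (* The string of [f] ends at the unique zero [n.+1], so no earlier positive index is a zero; this
     is what simplicity of the module generated by [f] requires. *)
  have coef_neq0 j : (0 < j <= n)%N ->
      lowering_coef xi (fun i => chi (iter i sigma h)) j != 0.
    move=> /andP[j0 jn]; apply/eqP => cj; move: cn.
    under lowering_coef_eq => j' do rewrite dnE; move=> cn.
    have := coefP _ (weight_vector_character Wf f0) _ _ j0 _ cj cn.
    by move=> /(_ isT) ej; rewrite ej ltnn in jn.
  apply: (in_simple_sum_simple
    (highest_weight_module_simple Wf Ef coef_neq0 Fn f0)).
  elim: i => [|i [x IH]]; first by exists 1; rewrite scale1r.
  by exists (Xm sigma h xi * x); rewrite -scalerA -IH.
have [n [e eV]] := Vf.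
apply: (semisimple_of_generators (e := e)) => [M sM Me|i].
  apply/seteqP; split => // v _; have [c ->] := eV v.
  apply: submodule_sum => // i _; rewrite -[_ *: _]addr0.
  by have [M0 MZ] := (submoduleP M).1 sM; exact: MZ.
have [s [w [sP ->]]] := Vw.1 (e i).
rewrite big_seq; apply: in_simple_sum_sum => m /sP[mmax mw].
have [chi Wm] := weight_space_character (v := w m) Vf mmax mw.
have [k Ek] := Enil _ _ Wm.
have [f [fP ->]] := highest_weight_decomposition xi0 upK
  (@weight_vector0 _ _ _ _ _ V) (@weight_vector_linear _ _ _ _ _ V)
  (@weight_vector_up _ _ _ _ _ V) (@weight_vector_down _ _ _ _ _ V)
  (@weight_vector_EF _ _ _ _ _ V) Enil Fnil coef_zero dual_coef_zero Wm Ek.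
apply: in_simple_sum_sum => j _; have [Wf Ef] := fP j.
exact: simpleF Wf Ef.
Qed.

End SemisimplicityCriterion.

(** * The Hopf structure on weights *)

Section EigenvectorCoefficients.
Variables (K : fieldType) (R : algType K) (f : {lrmorphism R -> R}).
Variables (r l h : R) (chi : R -> K) (xi s : K).
Hypotheses (charK : [pchar K] =i pred0) (xi_neq0 : xi != 0) (s_neq0 : s != 0).
Hypotheses (chi_character : is_character chi) (chir : chi r != 0).

Lemma iter_eigenvector c a i : f a = c *: a -> iter i f a = c ^+ i *: a.
Proof.
move=> fa; elim: i => [|i IH]; first by rewrite scale1r.
by rewrite iterS IH linearZ /= fa scalerA -exprSr.
Qed.

Lemma iter_linear_comb c d a b i :
  iter i f (c *: a + d *: b) = c *: iter i f a + d *: iter i f b.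
Proof. by elim: i => // i IH; rewrite !iterS IH linearD !linearZ. Qed.

Lemma character_linear_comb c d a b : chi (c *: a + d *: b) = c * chi a + d * chi b.
Proof.
have [_ _ chiL] := chi_character; have := chiL d b 0.
have -> : chi 0 = 0 by have := chiL (-1) 0 0; rewrite scaler0 addr0 mulN1r addNr.
by rewrite !addr0 chiL => ->.
Qed.

(** Here [h] is a combination of eigenvectors of [f], so its iterates are explicit geometric
    progressions. The map [f] stands for [sigma] (with [s = 1]) or its inverse (with
    [s = - xi^-1]). *)
Lemma coef_at_most_one_zero_q q p kappa : q * p = 1 ->
  (forall n, (0 < n)%N -> q ^+ n != 1) -> kappa != 0 ->
  h = kappa *: r + (- kappa) *: l ->
  f r = (xi * p) *: r -> f l = (xi * q) *: l ->
  at_most_one_zero (lowering_coef xi (fun i => s * chi (iter i f h))).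
Proof.
move=> qp qn k0 hE fr fl.
rewrite (_ : (fun i => _) = fun n => s * kappa * xi ^+ n *
    (p ^+ n * chi r - q ^+ n * chi l)).
  by apply: at_most_one_zero_q => //; rewrite ?mulf_neq0// -(expr1 q) qn.
apply/funext => n; rewrite hE iter_linear_comb !(iter_eigenvector _ fr, iter_eigenvector _ fl).
by rewrite !scalerA character_linear_comb !exprMn; ring.
Qed.

(** On [h] and [r] the map [f] acts like a Jordan block with eigenvalue [xi * q], whence the factor
    [i%:R] in its iterates; [q] is 1 or -1. *)
Lemma coef_at_most_one_zero_1 q beta : q ^+ 2 = 1 -> beta != 0 ->
  f r = (xi * q) *: r -> f h = (xi * q) *: (h + beta *: r) ->
  at_most_one_zero (lowering_coef xi (fun i => s * chi (iter i f h))).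
Proof.
move=> q2 b0 fr fh.
have fi i : iter i f h = (xi * q) ^+ i *: h + ((xi * q) ^+ i * (i%:R * beta)) *: r.
  elim: i => [|i IH]; first by rewrite mul0r mulr0 scale0r addr0 scale1r.
  rewrite iterS IH linearD !linearZ /= fr fh scalerDr scalerDr !scalerA -addrA.
  rewrite -scalerDl exprSr; congr (_ + _ *: _).
  by rewrite -natr1; ring.
have -> : (fun i => s * chi (iter i f h)) =
    fun i => (xi * q) ^+ i * (s * chi h + i%:R * (s * (beta * chi r))).
  by apply/funext => i; rewrite fi character_linear_comb; ring.
have sb : s * (beta * chi r) != 0 by rewrite !mulf_neq0.
have /eqP := q2; rewrite sqrf_eq1 => /orP[/eqP ->|/eqP ->].
  by rewrite mulr1; exact: at_most_one_zero_1.
by rewrite mulrN1; exact: at_most_one_zero_N1.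
Qed.

End EigenvectorCoefficients.

Section Tensors.
Variables (K : fieldType) (R : algType K).

Lemma tmap_tens (f g : {linear R -> R}) a b : tmap f g (tens a b) = tens (f a) (g b).
Proof.
rewrite /tmap tlift_tens//; have [tl tr] := tens_bilin R R.
by split=> [b' c u u'|a' c v v'] /=; rewrite linearP; [exact: tl|exact: tr].
Qed.

Lemma tmap_linear (f g : {linear R -> R}) : linear (tmap f g).
Proof.
apply: tlift_linear; have [tl tr] := tens_bilin R R.
by split=> [b' c u u'|a' c v v'] /=; rewrite linearP; [exact: tl|exact: tr].
Qed.

Variable eps : {lrmorphism R -> K | *%R}.

Lemma counit_bilinl : bilin (fun b c : R => eps b *: c).
Proof.
split=> [b c u u'|a c v v'] /=; first by rewrite linearP scalerDl scalerA.
by rewrite scalerDr !scalerA mulrC.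
Qed.

Lemma counit_bilinr : bilin (fun b c : R => eps c *: b).
Proof.
split=> [b c u u'|a c v v'] /=; last by rewrite linearP scalerDl scalerA.
by rewrite scalerDr !scalerA mulrC.
Qed.

Lemma counit_bilin2 : bilin (fun b c : R => (eps b * eps c : K^o)).
Proof.
split=> [b c u u'|a c v v'] /=; rewrite linearP.
  by rewrite mulrDl -mulrA.
by rewrite mulrDr mulrCA.
Qed.

End Tensors.

(** * The counit and [sigma] *)

Section CounitShift.
Variables (K : fieldType) (R : comUnitAlgType K) (H : hopf_algebra R).
Variable sigma : alg_aut R.
Hypothesis sigma_comul_l :
  forall a, tmap sigma id (hcomul H a) = hcomul H (sigma a).
Hypothesis sigma_comul_r :
  forall a, tmap id sigma (hcomul H a) = hcomul H (sigma a).
Local Notation eps := (hcounit H).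

Lemma grouplikeM a b : grouplike H a -> grouplike H b -> grouplike H (a * b).
Proof.
move=> [a1 a2] [b1 b2]; split; last by rewrite rmorphM /= a2 b2 mulr1.
by rewrite rmorphM a1 b1; exact: tmul_tens.
Qed.

(** The antipode axiom makes a grouplike element invertible, with inverse its antipode. *)
Lemma grouplike_character_neq0 (chi : R -> K) g : grouplike H g ->
  is_character chi -> chi g != 0.
Proof.
move=> [gg g1] [chi1 chiM _]; have := hantipodel H g.
rewrite gg tlift_tens ?g1 ?scale1r.
  move=> Sg; apply/eqP => chig; have := chi1.
  by rewrite -Sg chiM chig mulr0 => /eqP; rewrite eq_sym oner_eq0.
split=> [b c u u'|a c v v'] /=; first by rewrite linearP mulrDl -scalerAl.
by rewrite mulrDr -scalerAr.
Qed.

(** The counit axiom is applied to [sigma g], whose coproduct is [sigma g] tensor [g]. *)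
Lemma sigma_grouplike g : grouplike H g -> sigma g = eps (sigma g) *: g.
Proof.
move=> [gg _]; rewrite -[LHS](hcounitl H) -sigma_comul_l gg.
by rewrite (tmap_tens sigma idfun) tlift_tens//; exact: counit_bilinl.
Qed.

(** The same argument with the counit on the left factor; [sigma_skew_primitive_r] puts it on the
    right. Comparing the two expressions for [sigma h] ties [h] to [r] and [l]. *)
Lemma sigma_skew_primitive_l h r l : hcomul H h = tens h r + tens l h ->
  sigma h = eps (sigma h) *: r + eps (sigma l) *: h.
Proof.
move=> hh; rewrite -[LHS](hcounitl H) -sigma_comul_l hh.
have bl := counit_bilinl eps.
have := tmap_linear sigma idfun 1 (tens h r) (tens l h); rewrite !scale1r => ->.
have := tlift_linear bl 1; rewrite !(tmap_tens sigma idfun).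
move=> /(_ (tens (sigma h) r) (tens (sigma l) h)).
by rewrite !scale1r !tlift_tens.
Qed.

Lemma sigma_skew_primitive_r h r l : hcomul H h = tens h r + tens l h ->
  sigma h = eps (sigma r) *: h + eps (sigma h) *: l.
Proof.
move=> hh; rewrite -[LHS](hcounitr H) -sigma_comul_r hh.
have bl := counit_bilinr eps.
have := tmap_linear idfun sigma 1 (tens h r) (tens l h); rewrite !scale1r => ->.
have := tlift_linear bl 1; rewrite !(tmap_tens idfun sigma).
move=> /(_ (tens h (sigma r)) (tens l (sigma h))).
by rewrite !scale1r !tlift_tens.
Qed.

Lemma counit_sigma_scale l r xi : grouplike H l -> grouplike H r ->
  tens (sigma l) (sigma r) = xi *: tens l r -> eps (sigma l) * eps (sigma r) = xi.
Proof.
move=> [_ l1] [_ r1] e; have bl := counit_bilin2 eps.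
have := congr1 (tlift (fun b c : R => (eps b * eps c : K^o))) e.
have := tlift_linear bl xi (tens l r) 0; rewrite addr0 => ->.
have := tlift_linear bl (-1) 0 0; rewrite scaler0 addr0 scaleN1r addNr => ->.
by rewrite !tlift_tens// l1 r1 mulr1 addr0 => ->; exact: mulr1.
Qed.

(** The ideal is the image of the kernel of [eps] under [sigma], that is, the kernel of the
    character [eps \o aut_inv sigma]. *)
Lemma value_at_int_ideal1 a :
  value_at a (int_ideal H sigma 1) = eps (aut_inv sigma a).
Proof.
have idealE b : int_ideal H sigma 1 b <-> eps (aut_inv sigma b) = 0.
  split=> [[c c0 <-]|b0]; first by rewrite /= autK.
  by exists (aut_inv sigma b) => //=; rewrite autVK.
have valE c : int_ideal H sigma 1 (a - c%:A) <-> c = eps (aut_inv sigma a).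
  rewrite idealE linearB linearZ rmorph1 linearB linearZ rmorph1 /= mulr1.
  by split=> [/eqP|->]; rewrite ?subrr// subr_eq0 => /eqP.
by apply: xget_unique => [|c]; apply valE.
Qed.

End CounitShift.

(** [orderN] is also [None] when [q ^+ 2 = 1], so that case is excluded separately. *)
Lemma orderN_None (K : fieldType) (q : K) : orderN q = None ->
  q ^+ 2 != 1 -> forall n, (0 < n)%N -> q ^+ n != 1.
Proof.
rewrite /orderN /mul_order => + /negPf q2; rewrite q2; case: asboolP => // qn _ n n0.
by apply/eqP => q1; apply: qn; exists n.
Qed.

Theorem theorem8p3 (K : closedFieldType) (charK : [pchar K] =i pred0)
    (R : comUnitAlgType K) (fgR : fin_gen_alg R)
    (sigma : alg_aut R) (h : R) (xi : K) (xi_neq0 : xi != 0)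
    (H : hopf_algebra R) (rp rm lp lm sp sm : R)
    (sigma_comul_l : forall a, tmap sigma id (hcomul H a) = hcomul H (sigma a))
    (sigma_comul_r : forall a, tmap id sigma (hcomul H a) = hcomul H (sigma a))
    (antipode_sigma : forall a,
       hantipode H (sigma a) = aut_inv sigma (hantipode H a))
    (comul_h : hcomul H h = tens h (rp * rm) + tens (lp * lm) h)
    (counit_h : hcounit H h = 0)
    (antipode_h : hantipode H h = - (lp * lm * rp * rm)^-1 * h)
    (rp_grouplike : grouplike H rp) (rm_grouplike : grouplike H rm)
    (lp_grouplike : grouplike H lp) (lm_grouplike : grouplike H lm)
    (sigma_lp_rm : tens (sigma lp) (sigma rm) = xi *: tens lp rm)
    (sigma_lm_rp : tens (sigma lm) (sigma rp) = xi *: tens lm rp)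
    (sp_unit : sp \is a GRing.unit) (sm_unit : sm \is a GRing.unit)
    (sp_inv : sp^-1 = - lp * sigma rp)
    (sm_inv : sm^-1 = - lm * aut_inv sigma rm)
    (torsion_free : forall (n : int) (m : set R), n != 0 -> maximal_ideal m ->
       aut_iter sigma n @` m <> m)
    (N_infinite : orderN (xi * value_at (rp * rm) (int_ideal H sigma 1)) = None)
    (h1_neq0 : value_at h (int_ideal H sigma 1) != 0)
    (V : lmodType (ambiskew sigma h xi))
    (V_fin_dim : fin_dim V) (V_weight : weight_module V) :
  semisimple V.
Proof.
set r := rp * rm in comul_h N_infinite; set l := lp * lm in comul_h.
rewrite !value_at_int_ideal1 in N_infinite h1_neq0.
set eps := hcounit H in N_infinite h1_neq0.
set r1 := eps (aut_inv sigma r) in N_infinite.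
set h1 := eps (aut_inv sigma h) in h1_neq0.
have r_grouplike : grouplike H r by exact: grouplikeM.
have l_grouplike : grouplike H l by exact: grouplikeM.
set c := eps (sigma r); set d := eps (sigma l); set h0 := eps (sigma h).
have sr : sigma r = c *: r by exact: sigma_grouplike.
have sl : sigma l = d *: l by exact: sigma_grouplike.
have shl : sigma h = h0 *: r + d *: h by exact: sigma_skew_primitive_l.
have shr : sigma h = c *: h + h0 *: l by exact: sigma_skew_primitive_r.
(* The product of the two relations obtained by applying the counit to both factors of [sigma_lp_rm]
   and [sigma_lm_rp]. *)
have dc : d * c = xi ^+ 2.
  rewrite /d /c /r /l !rmorphM /= expr2 -{1}(counit_sigma_scale lp_grouplike
    rm_grouplike sigma_lp_rm) -(counit_sigma_scale lm_grouplike rp_grouplike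
    sigma_lm_rp) -/eps; ring.
have inv_eigen a b : sigma a = b *: a -> a = b *: aut_inv sigma a.
  by move=> e; rewrite -[LHS](autK sigma) e linearZ.
have cr1 : c * r1 = 1.
  by case: r_grouplike => _ <-; rewrite -/eps (inv_eigen _ _ sr) linearZ.
(* [q] is the scalar whose order is [N], and [p] is its inverse; [sigma] then has eigenvalue
   [xi * p] on [r] and [xi * q] on [l]. *)
pose q := xi * r1; pose p := xi^-1 * c.
have qp : q * p = 1 by rewrite /q /p mulrACA mulfV// [r1 * c]mulrC cr1 mulr1.
have cE : c = xi * p by rewrite /p mulVKf.
have dE : d = xi * q by rewrite /q mulrA -expr2 -dc -mulrA cr1 mulr1.
have q0 : q != 0 by apply: contra_eq_neq qp => ->; rewrite mul0r eq_sym oner_eq0.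
have d0 : d != 0 by rewrite dE mulf_neq0.
(* Applying the inverse of [sigma] and then the counit to [shl] gives [0 = h0 * r1 + d * h1]; here
   [h1 != 0] enters. *)
have h00 : h0 != 0.
  have e : 0 = h0 * r1 + d * h1.
    rewrite -counit_h -/eps -{1}(autK sigma h) shl linearD !linearZ /= linearD.
    by rewrite !linearZ.
  apply: contra_eq_neq e => ->; rewrite mul0r add0r eq_sym.
  by rewrite mulf_neq0.
have ir : aut_inv sigma r = (xi^-1 * q) *: r.
  rewrite {2}(inv_eigen _ _ sr) scalerA cE mulrACA mulVf// mul1r qp.
  by rewrite scale1r.
have il : aut_inv sigma l = (xi^-1 * p) *: l.
  rewrite {2}(inv_eigen _ _ sl) scalerA dE mulrACA mulVf// mul1r mulrC qp.
  by rewrite scale1r.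
have xiV0 : xi^-1 != 0 by rewrite invr_eq0.
have nxiV0 : - xi^-1 != 0 by rewrite oppr_eq0.
suff [coefP dual_coefP] :
    (forall chi, is_character chi -> at_most_one_zero
       (lowering_coef xi (fun i => 1 * chi (iter i sigma h)))) /\
    (forall chi, is_character chi -> at_most_one_zero
       (lowering_coef xi^-1 (fun i => - xi^-1 * chi (iter i (aut_inv sigma) h)))).
  apply: (weight_module_semisimple xi_neq0 torsion_free) V_fin_dim V_weight => //.
  move=> chi /coefP; congr (at_most_one_zero (lowering_coef _ _)).
  by apply/funext => i; rewrite mul1r.
have chir chi := grouplike_character_neq0 (chi := chi) r_grouplike.
have [q2|q2] := eqVneq (q ^+ 2) 1; last first.
  have qn n : (0 < n)%N -> q ^+ n != 1 by exact: orderN_None N_infinite q2 n.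
  have pn n : (0 < n)%N -> p ^+ n != 1.
    move=> /qn; apply: contraNneq => pn1.
    by rewrite -[q ^+ n]mulr1 -{1}pn1 -exprMn qp expr1n.
  have pq : xi * p - xi * q != 0.
    rewrite -mulrBr mulf_neq0// subr_eq0; apply: contraNneq q2 => pq.
    by rewrite expr2 -{2}pq qp.
  (* Equating [shl] and [shr] gives [(c - d) *: h = h0 *: (r - l)], and [c != d] because
     [q ^+ 2 != 1]. *)
  have hE : h = (h0 / (xi * p - xi * q)) *: r + (- (h0 / (xi * p - xi * q))) *: l.
    apply: (scalerI pq); rewrite scalerDr !scalerA mulrN [_ * (h0 / _)]mulrCA mulfV// mulr1.
    rewrite scaleNr scalerBl -cE -dE; apply/eqP.
    by rewrite subr_eq addrAC eq_sym subr_eq -shl -shr.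
  have k0 : h0 / (xi * p - xi * q) != 0 by rewrite mulf_neq0// invr_eq0.
  split=> chi chiC.
    apply: (coef_at_most_one_zero_q xi_neq0 (oner_neq0 K) chiC (chir _ chiC) qp qn k0 hE).
      by rewrite sr cE.
    by rewrite sl dE.
  (* For the inverse of [sigma] the roles of [p] and [q] are exchanged and [xi] becomes [xi^-1]. *)
  have pq1 : p * q = 1 by rewrite mulrC.
  exact: (coef_at_most_one_zero_q xiV0 nxiV0 chiC (chir _ chiC) pq1 pn k0 hE ir il).
(* When [q ^+ 2 = 1], the eigenvalues on [r] and [h] coincide, and [shl] is the Jordan block
   relation with [beta = (xi * q)^-1 * h0]. *)
have pE : p = q by apply: (mulfI q0); rewrite qp -expr2.
have dq0 : xi * q != 0 by rewrite -dE.
have b0 : (xi * q)^-1 * h0 != 0 by rewrite mulf_neq0// invr_eq0.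
split=> chi chiC.
  apply: (coef_at_most_one_zero_1 charK xi_neq0 (oner_neq0 K) chiC (chir _ chiC) q2 b0).
    by rewrite /= sr cE pE.
  by rewrite scalerDr scalerA mulVKf//= shl dE addrC.
(* Inverting the Jordan block changes the sign of [beta]. *)
have nb0 : - ((xi * q)^-1 * h0) != 0 by rewrite oppr_eq0.
apply: (coef_at_most_one_zero_1 charK xiV0 nxiV0 chiC (chir _ chiC) q2 nb0 ir).
have qV : (xi * q)^-1 = xi^-1 * q.
  by apply: (mulfI dq0); rewrite mulfV// mulrACA mulfV// mul1r -expr2.
have e : h = (h0 * (xi * q)^-1) *: r + (xi * q) *: aut_inv sigma h.
  by rewrite -{1}(autK sigma h) shl linearD !linearZ /= ir dE qV scalerA.
apply: (scalerI dq0); rewrite scalerA -qV mulfV// scale1r scaleNr [_^-1 * h0]mulrC.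
by rewrite {2}e addrAC subrr add0r.
Qed.
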